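(* Let $W$ be a binary-input cq channel and $\delta\in(0,1)$. As $N=2^n\to\infty$ through powers of two, $$\frac1N\big|\{i\in\{1,\dots,N\}: I(W_N^{(i)})\in(1-\delta,1]\}\big|\to I(W),\qquad \frac1N\big|\{i\in\{1,\dots,N\}: I(W_N^{(i)})\in[0,\delta)\}\big|\to 1-I(W).$$
   Context: A binary-input cq channel $W$ assigns to $x\in\{0,1\}$ a density operator $\rho_x$ on a finite-dimensional Hilbert space. For a binary-input cq channel $V:x\mapsto\sigma_x$, $I(V)=H(\tfrac12(\sigma_0+\sigma_1))-\tfrac12H(\sigma_0)-\tfrac12H(\sigma_1)$, $H(\sigma)=-\mathrm{Tr}\{\sigma\log_2\sigma\}$. Channel combining: for $N=2^n$ define $\rho_{u^N}$ on $B^N=B_1\cdots B_N$ recursively by $\rho_{u_1}=\rho_{u_1}$ ($N=1$) and $\rho_{u^{2N}}=\rho^{B_1\cdots B_N}_{u_o\oplus u_e}\otimes\rho^{B_{N+1}\cdots B_{2N}}_{u_e}$ with $u_o=(u_1,u_3,\dots,u_{2N-1})$, $u_e=(u_2,\dots,u_{2N})$. Split channels: $\overline\rho_{u_1^i}=\sum_{u_{i+1}^N}2^{-(N-i)}\rho_{u^N}$ and $W_N^{(i)}:u_i\mapsto\sum_{u_1^{i-1}}2^{-(i-1)}|u_1^{i-1}\rangle\langle u_1^{i-1}|^{U_1^{i-1}}\otimes\overline\rho_{u_1^i}^{B^N}$, with $U_1^{i-1}$ a classical register with orthonormal basis $\{|u_1^{i-1}\rangle\}$. *)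

(* Defs.v *)
From Stdlib Require Import Reals Arith List ClassicalEpsilon.
Open Scope R_scope.

Record Cx := mkCx { cre : R ; cim : R }.
Definition Cx0 : Cx := mkCx 0 0.
Definition Cx1 : Cx := mkCx 1 0.
Definition RC (r : R) : Cx := mkCx r 0.
Definition Cadd (a b : Cx) : Cx := mkCx (cre a + cre b) (cim a + cim b).
Definition Cmul (a b : Cx) : Cx :=
  mkCx (cre a * cre b - cim a * cim b) (cre a * cim b + cim a * cre b).
Definition Cconj (a : Cx) : Cx := mkCx (cre a) (- cim a).

Fixpoint Csum (n : nat) (f : nat -> Cx) : Cx :=
  match n with O => Cx0 | S k => Cadd (Csum k f) (f k) end.
Fixpoint Rsum (n : nat) (f : nat -> R) : R :=
  match n with O => 0 | S k => Rsum k f + f k end.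

(** * Matrices: a matrix on a d-dimensional space C^d is a function
    nat -> nat -> Cx whose entries (i,j) with i,j < d are meaningful
    (computational basis |0>,...,|d-1>). *)
Definition Mat := nat -> nat -> Cx.
Definition Mzero : Mat := fun _ _ => Cx0.
Definition Madd (A B : Mat) : Mat := fun i j => Cadd (A i j) (B i j).
Definition Mscale (r : R) (A : Mat) : Mat := fun i j => Cmul (RC r) (A i j).
Fixpoint Msum (n : nat) (f : nat -> Mat) : Mat :=
  match n with O => Mzero | S k => Madd (Msum k f) (f k) end.

(** Tensor (Kronecker) product A (x) B, where B acts on a space of dimension dB;
    basis vector |a>|b> of the product is indexed by a*dB+b. *)
Definition kron (dB : nat) (A B : Mat) : Mat :=
  fun i j => Cmul (A (i / dB)%nat (j / dB)%nat) (B (i mod dB)%nat (j mod dB)%nat).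

Definition ket_bra (a : nat) : Mat :=
  fun i j => if (Nat.eqb i a && Nat.eqb j a)%bool then Cx1 else Cx0.

Definition is_hermitian (d : nat) (A : Mat) : Prop :=
  forall i j, (i < d)%nat -> (j < d)%nat -> A j i = Cconj (A i j).
Definition is_psd (d : nat) (A : Mat) : Prop :=
  forall v : nat -> Cx,
    0 <= cre (Csum d (fun i => Csum d (fun j => Cmul (Cmul (Cconj (v i)) (A i j)) (v j)))).
Definition is_density (d : nat) (rho : Mat) : Prop :=
  is_hermitian d rho /\ is_psd d rho /\ Csum d (fun i => rho i i) = Cx1.

(** * Von Neumann entropy  H(rho) = - Tr rho log2 rho = - sum_k lam_k log2 lam_k,
    lam the eigenvalues of rho (spectral decomposition rho = U diag(lam) U^dagger). *)
Definition is_unitary (d : nat) (U : Mat) : Prop :=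
  forall i j, (i < d)%nat -> (j < d)%nat ->
    Csum d (fun k => Cmul (U i k) (Cconj (U j k))) = if Nat.eqb i j then Cx1 else Cx0.
Definition is_spectrum (d : nat) (rho : Mat) (lam : nat -> R) : Prop :=
  exists U, is_unitary d U /\
    forall i j, (i < d)%nat -> (j < d)%nat ->
      rho i j = Csum d (fun k => Cmul (Cmul (U i k) (RC (lam k))) (Cconj (U j k))).
(** a (choice of) eigenvalue list; the entropy does not depend on the choice *)
Definition spectrum (d : nat) (rho : Mat) : nat -> R :=
  epsilon (inhabits (fun _ : nat => 0)) (is_spectrum d rho).
Definition log2 (x : R) : R := ln x / ln 2.
(** x log2 x with the convention 0 log 0 = 0 *)
Definition xlogx (x : R) : R := if Rle_dec x 0 then 0 else x * log2 x.
Definition vN_entropy (d : nat) (rho : Mat) : R :=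
  - Rsum d (fun k => xlogx (spectrum d rho k)).

Definition is_cq_channel (d : nat) (W : bool -> Mat) : Prop :=
  forall x, is_density d (W x).
Definition sym_info (d : nat) (V : bool -> Mat) : R :=
  vN_entropy d (Mscale (1/2) (Madd (V false) (V true)))
  - (1/2) * vN_entropy d (V false) - (1/2) * vN_entropy d (V true).

(** * Channel combining. Inputs u^N (N = 2^n) are given 0-indexed as
    u : nat -> bool, u k = u_{k+1}.  combined d W n u acts on dimension d^(2^n).
    u_o = (u_1,u_3,..) is k |-> u (2k), u_e = (u_2,u_4,..) is k |-> u (2k+1). *)
Fixpoint combined (d : nat) (W : bool -> Mat) (n : nat) (u : nat -> bool) : Mat :=
  match n with
  | O => W (u O)
  | S n' =>
      kron (d ^ (2 ^ n'))
        (combined d W n' (fun k => xorb (u (2 * k)%nat) (u (2 * k + 1)%nat)))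
        (combined d W n' (fun k => u (2 * k + 1)%nat))
  end.

(** For 1 <= i <= N: the input sequence with u_1^{i-1} encoded by the bits of a
    (bit k of a = u_{k+1}), u_i = x, and u_{i+1}^N encoded by the bits of m
    (bit k of m = u_{i+1+k}). *)
Definition assign (i a : nat) (x : bool) (m : nat) : nat -> bool :=
  fun k => if Nat.ltb k (i - 1) then Nat.testbit a k
           else if Nat.eqb k (i - 1) then x
           else Nat.testbit m (k - i).

(** overline rho_{u_1^i} = sum_{u_{i+1}^N} 2^{-(N-i)} rho_{u^N} *)
Definition avg_state (d : nat) (W : bool -> Mat) (n i a : nat) (x : bool) : Mat :=
  Msum (2 ^ (2 ^ n - i))
    (fun m => Mscale (/ 2 ^ (2 ^ n - i)) (combined d W n (assign i a x m))).

(** W_N^{(i)} : u_i |-> sum_{u_1^{i-1}} 2^{-(i-1)} |u_1^{i-1}><u_1^{i-1}| (x) overline rho,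
    acting on dimension 2^(i-1) * d^N. *)
Definition split_channel (d : nat) (W : bool -> Mat) (n i : nat) : bool -> Mat :=
  fun x => Msum (2 ^ (i - 1))
    (fun a => kron (d ^ (2 ^ n)) (Mscale (/ 2 ^ (i - 1)) (ket_bra a)) (avg_state d W n i a x)).

Definition split_info (d : nat) (W : bool -> Mat) (n i : nat) : R :=
  sym_info (2 ^ (i - 1) * d ^ (2 ^ n)) (split_channel d W n i).

Definition in_good (delta r : R) : bool :=
  if Rlt_dec (1 - delta) r then (if Rle_dec r 1 then true else false) else false.
Definition in_bad (delta r : R) : bool :=
  if Rle_dec 0 r then (if Rlt_dec r delta then true else false) else false.

Definition count_good (d : nat) (W : bool -> Mat) (delta : R) (n : nat) : nat :=
  length (filter (fun i => in_good delta (split_info d W n i)) (seq 1 (2 ^ n))).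
Definition count_bad (d : nat) (W : bool -> Mat) (delta : R) (n : nat) : nat :=
  length (filter (fun i => in_bad delta (split_info d W n i)) (seq 1 (2 ^ n))).

(* Main.v *)
(** Write Z(W) = Tr sqrt(rho_0) sqrt(rho_1).  One combining step turns a pair of copies of W
    into W^- and W^+ with I(W^-) + I(W^+) = 2 I(W), by additivity of the entropy on tensor
    products, and Z(W^+) = Z(W)^2.  Summing relative entropies D(rho_x || (rho_0+rho_1)/2)
    over pairs of eigenvectors gives, with no dependence on the dimension,
      0 <= I <= 1,   I >= 1 - Z / ln 2,   I ln 2 <= (1 - Z) / e + 2 e  for all e > 0.
    Since I is a bounded martingale on the binary tree, its mean square increments per level
    tend to 0.  A node with I in [c, 1-c] has Z <= 1 - eta(c), so after boundedly many
    plus-steps Z is tiny and I has moved by c/2; hence the fraction of such nodes tends to 0,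
    and the conserved mean of I determines the two limits. *)

(* The obstacle is the dimension: at level n the states live on a space of dimension d^(2^n) or
   more, so continuity estimates for the entropy with a log-dimension factor say nothing. Write
   sigma = (rho_0 + rho_1)/2. All three bounds come from tangent lines of [ln] applied to ratios of
   eigenvalues; ln 2 appears because the extreme case, orthogonal inputs, has rho_x = 2 sigma on its
   support. The relation rho_x <= 2 sigma also gives Tr rho_x^2 sigma^-1 <= 2, which replaces any
   lower bound on the eigenvalues. The sums obtained contain Tr sqrt(rho_x) sqrt(sigma), and two
   trace inequalities between the roots turn these into Z; this is where noncommutativity has to be
   overcome.

   The word copies hides a second point. W_N^(i) carries the known bits, and the two halves of the
   combined state see different prefixes. One step is therefore proved for two different channels
   and then averaged. The known inputs of the two halves are independent and uniform, and this is
   why the averaged Z is exactly squared. Nothing is estimated about Z(W^-): from every node only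
   plus-steps are followed. *)
Require Import Defs.
From Stdlib Require Import Reals Arith List ClassicalEpsilon FunctionalExtensionality Lra Lia.
Open Scope R_scope.

(** * Scalar inequalities *)

Lemma ln_le_sub1 (t : R) : 0 < t -> ln t <= t - 1.
Proof.
  intros Ht. pose proof (exp_ineq1_le (ln t)) as H. rewrite exp_ln in H; lra.
Qed.

(** The tangent line of [ln] at [k], evaluated at a / c. Below, [k] is the ratio at which the bound
    has to be sharp: 1 for equal eigenvalues, 2 or 1/sqrt 2 for l = 2 m, the case of orthogonal
    inputs. *)
Lemma ln_ratio_le (k a c : R) : 0 < k -> 0 < a -> 0 < c -> ln a - ln c <= ln k + a / (k * c) - 1.
Proof.
  intros Hk Ha Hc.
  assert (Hp : 0 < a / (k * c)) by (apply Rdiv_lt_0_compat; nra).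
  pose proof (ln_le_sub1 _ Hp) as H.
  unfold Rdiv in H at 1. rewrite ln_mult, ln_Rinv, ln_mult in H; try nra.
Qed.

Lemma ln_sqrt_half (x : R) : 0 < x -> ln x = 2 * ln (sqrt x).
Proof.
  intros Hx. rewrite <- (sqrt_sqrt x) at 1 by lra.
  rewrite ln_mult; try lra; now apply sqrt_lt_R0.
Qed.

Lemma ln2_pos : 0 < ln 2.
Proof. rewrite <- ln_1. apply ln_increasing; lra. Qed.

Lemma nats_of_bits (a b c L : R) : L <> 0 ->
  (- (c / L) - 1 / 2 * - (a / L) - 1 / 2 * - (b / L)) * L = (a + b) / 2 - c.
Proof. intros; field; easy. Qed.

Section Pointwise.
Variables l m : R.
Hypothesis Hl : 0 <= l.
Hypothesis Hm : 0 <= m.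
(** Absolute continuity. As [ln 0] is 0 by definition, a term with m = 0 < l would be finite instead
    of infinite. *)
Hypothesis Hlm : m = 0 -> l = 0.

Lemma kl_ge_sub : l - m <= l * ln l - l * ln m.
Proof.
  destruct (Rle_lt_or_eq_dec 0 l Hl) as [H|<-]; [|lra].
  assert (0 < m) by (destruct Hm; [easy | symmetry in H0; apply Hlm in H0; lra]).
  pose proof (ln_ratio_le 1 m l) as K. rewrite ln_1 in K.
  assert (E : l * (m / (1 * l)) = m) by (field; lra). nra.
Qed.

(** The left factor is rewritten by l (ln l - ln m) = -2 l ln (sqrt m / sqrt l), and the tangent of
    [ln] is taken at 1/sqrt 2. Equality then holds for l = 2 m, so that the full ln 2 survives. *)
Lemma kl_ge_sqrt : l * ln 2 + 2 * l - 2 * sqrt 2 * (sqrt l * sqrt m) <= l * ln l - l * ln m.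
Proof.
  destruct (Rle_lt_or_eq_dec 0 l Hl) as [H|<-]; [|rewrite sqrt_0; lra].
  assert (0 < m) by (destruct Hm; [easy | symmetry in H0; apply Hlm in H0; lra]).
  pose proof (sqrt_lt_R0 l H); pose proof (sqrt_lt_R0 m H0).
  assert (0 < sqrt 2) by (apply sqrt_lt_R0; lra).
  rewrite (ln_sqrt_half l), (ln_sqrt_half m), (ln_sqrt_half 2) by lra.
  pose proof (ln_ratio_le (/ sqrt 2) (sqrt m) (sqrt l) ltac:(now apply Rinv_0_lt_compat)) as K.
  rewrite ln_Rinv in K by easy. specialize (K H2 H1).
  assert (E : l * (sqrt m / (/ sqrt 2 * sqrt l)) = sqrt 2 * (sqrt l * sqrt m)).
  { rewrite <- (sqrt_sqrt l) at 1 by lra. field; lra. }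
  nra.
Qed.

Lemma kl_le_chi2 : l * ln l - l * ln m <= l * ln 2 + (l * l) / m / 2 - l.
Proof.
  destruct (Rle_lt_or_eq_dec 0 l Hl) as [H|<-].
  2: { unfold Rdiv. lra. }
  assert (0 < m) by (destruct Hm; [easy | symmetry in H0; apply Hlm in H0; lra]).
  pose proof (ln_ratio_le 2 l m ltac:(lra) H H0) as K.
  assert (E : l * (l / (2 * m)) = l * l / m / 2) by (field; lra). nra.
Qed.

(** The tangent at 1 for the ratio sqrt l / sqrt m gives twice the product of sqrt l - sqrt m and l
    / sqrt m. The weight [e] splits it into a Hellinger term, small when Z is near 1, and a
    chi-squared term, bounded independently of the dimension. *)
Lemma kl_le_hellinger (e : R) : 0 < e ->
  l * ln l - l * ln m <= (sqrt l - sqrt m) * (sqrt l - sqrt m) / e + e * ((l * l) / m).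
Proof.
  intros He. assert (0 < / e) by now apply Rinv_0_lt_compat.
  destruct (Rle_lt_or_eq_dec 0 l Hl) as [H0|<-].
  2: { unfold Rdiv. pose proof (Rle_0_sqr (sqrt 0 - sqrt m)). unfold Rsqr in *. nra. }
  assert (Hm' : 0 < m) by (destruct Hm as [|E]; [easy | symmetry in E; apply Hlm in E; lra]).
  pose proof (sqrt_lt_R0 l H0) as Pa; pose proof (sqrt_lt_R0 m Hm') as Pc.
  rewrite (ln_sqrt_half l), (ln_sqrt_half m) by lra.
  pose proof (ln_ratio_le 1 (sqrt l) (sqrt m) ltac:(lra) Pa Pc) as K. rewrite ln_1 in K.
  assert (El : l = sqrt l * sqrt l) by (now rewrite sqrt_sqrt).
  assert (Em : m = sqrt m * sqrt m) by (now rewrite sqrt_sqrt).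
  set (a := sqrt l) in *; set (c := sqrt m) in *.
  (* AM-GM for the factors (a - c) and a^2 / c *)
  assert (Q : 2 * ((a - c) * (a ^ 2 / c)) <= (a - c) ^ 2 / e + e * (a ^ 2 / c) ^ 2).
  { assert (0 <= ((a - c) - e * (a ^ 2 / c)) ^ 2 / e)
      by (apply Rmult_le_pos; [apply pow2_ge_0 | lra]).
    replace (((a - c) - e * (a ^ 2 / c)) ^ 2 / e)
      with ((a - c) ^ 2 / e + e * (a ^ 2 / c) ^ 2 - 2 * ((a - c) * (a ^ 2 / c))) in H1
      by (field; lra). lra. }
  replace (l * l / m) with ((a ^ 2 / c) ^ 2)
    by (rewrite El, Em; field; lra).
  assert (E : l * (a / (1 * c) - 1) = (a - c) * (a ^ 2 / c)) by (rewrite El; field; lra).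
  nra.
Qed.
End Pointwise.

(** * Square roots and the Bhattacharyya parameter *)

Definition eqm (d : nat) (A B : Mat) : Prop :=
  forall i j, (i < d)%nat -> (j < d)%nat -> A i j = B i j.

Definition conj_diag (d : nat) (U : Mat) (lam : nat -> R) : Mat :=
  fun i j => Csum d (fun k => Cmul (Cmul (U i k) (RC (lam k))) (Cconj (U j k))).

(** The eigenbasis is kept as a witness, so that a tensor product of roots is again a root by
    construction. That the root does not depend on it is [sqrt_unique]. *)
Definition is_sqrt (d : nat) (rho S : Mat) : Prop :=
  exists U lam, is_unitary d U /\ (forall k, (k < d)%nat -> 0 <= lam k) /\
    eqm d rho (conj_diag d U lam) /\ eqm d S (conj_diag d U (fun k => sqrt (lam k))).

Definition msqrt (d : nat) (rho : Mat) : Mat := epsilon (inhabits Mzero) (is_sqrt d rho).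

Definition trprod (d : nat) (A B : Mat) : R :=
  cre (Csum d (fun i => Csum d (fun j => Cmul (A i j) (B j i)))).

Definition bhattacharyya (d : nat) (rho sigma : Mat) : R :=
  trprod d (msqrt d rho) (msqrt d sigma).

(* Linear in (i, z), so that the bounds survive averaging over the known bits. *)
Definition polar_bounds (i z : R) : Prop :=
  0 <= i <= 1 /\ 0 <= z <= 1 /\ 1 - z / ln 2 <= i /\
  forall e, 0 < e -> i * ln 2 <= (1 - z) / e + 2 * e.

Lemma hermitian_avg (d : nat) (A B : Mat) :
  is_hermitian d A -> is_hermitian d B -> is_hermitian d (Mscale (1/2) (Madd A B)).
Proof.
  intros HA HB i j Hi Hj. unfold Mscale, Madd. rewrite (HA i j), (HB i j) by easy.
  destruct (A i j), (B i j); unfold Cmul, Cadd, Cconj, RC; simpl; f_equal; ring.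
Qed.

Lemma polar_bounds_of_nats (i J z : R) : i * ln 2 = J -> 0 <= J -> J <= ln 2 ->
  ln 2 - z <= J -> (forall e, 0 < e -> J <= (1 - z) / e + 2 * e) -> 0 <= z -> z <= 1 ->
  polar_bounds i z.
Proof.
  intros <- H0 H1 H2 H3 Hz0 Hz1.
  assert (L : 0 < ln 2) by (rewrite <- ln_1; apply ln_increasing; lra).
  assert (E : z / ln 2 * ln 2 = z) by (field; lra).
  repeat split; try easy; nra.
Qed.

(** * Spectral estimates for a pair of states *)

Module Spectral.
From mathcomp Require Import all_boot all_order all_algebra.
From mathcomp Require Import complex Rstruct.
From mathcomp Require Import spectral.
From mathcomp Require Import ring lra.
Set Implicit Arguments. Unset Strict Implicit. Unset Printing Implicit Defensive.
Import Order.TTheory GRing.Theory Num.Theory.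
Local Open Scope ring_scope.
Local Open Scope complex_scope.
Local Open Scope sesquilinear_scope.
Local Notation R := Rdefinitions.R.
Local Notation C := (complex R).
Local Notation Re := complex.Re.
Local Notation ln := Rpower.ln.
Local Notation sqrt := R_sqrt.sqrt.

Section Spectral.
Variable d : nat.
Implicit Types (U V : 'M[C]_d) (l m : 'I_d -> R).

Definition rdiag l : 'M[C]_d := diag_mx (\row_i (l i)%:C).
Definition specmx U l : 'M[C]_d := U *m rdiag l *m U^t*.
(* |<u_i|v_j>|^2 for the columns u_i of U and v_j of V *)
Definition overlap U V i j := Re ((U^t* *m V) i j * ((U^t* *m V) i j)^*).
Definition specqf U l (v : 'cV[C]_d) :=
  \sum_k l k * Re ((U^t* *m v) k 0 * ((U^t* *m v) k 0)^*).
(* The diagonal of [specmx U l] in the basis V *)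
Definition pinch U V l j := \sum_i overlap U V i j * l i.

Lemma adjmxM p q r (A : 'M[C]_(p, q)) (B : 'M[C]_(q, r)) :
  (A *m B)^t* = B^t* *m A^t*.
Proof. by rewrite trmx_mul map_mxM. Qed.

Lemma rdiag_adj l : (rdiag l)^t* = rdiag l.
Proof.
apply/matrixP => i j; rewrite !mxE eq_sym; case: eqP => [->|_]; rewrite ?mulr1n ?mulr0n.
  exact: conjc_real.
exact: conjc0.
Qed.

Lemma specmx_adj U l : (specmx U l)^t* = specmx U l.
Proof. by rewrite /specmx !adjmxM trmxCK rdiag_adj mulmxA. Qed.

Lemma rdiag_mul l m : rdiag l *m rdiag m = rdiag (fun i => l i * m i).
Proof.
rewrite /rdiag mulmx_diag; congr diag_mx; apply/rowP => i; rewrite !mxE.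
by rewrite rmorphM.
Qed.

Lemma unitary_adj U : U *m U^t* = 1%:M -> U^t* *m U = 1%:M.
Proof. exact: mulmx1C. Qed.

Lemma specmx_mul U l m : U *m U^t* = 1%:M -> specmx U l *m specmx U m = specmx U (fun i => l i * m i).
Proof.
move=> /unitary_adj uU; rewrite /specmx -!mulmxA (mulmxA (U^t*) U) uU mul1mx.
by rewrite (mulmxA (rdiag l)) rdiag_mul !mulmxA.
Qed.

Lemma specmx_trace U l : U *m U^t* = 1%:M -> \tr (specmx U l) = (\sum_i l i)%:C.
Proof.
move=> /unitary_adj uU; rewrite /specmx mxtrace_mulC mulmxA uU mul1mx mxtrace_diag rmorph_sum.
by apply: eq_bigr => i _; rewrite !mxE.
Qed.

Lemma mulJ_Re (z : C) : z * z^* = (Re (z * z^*))%:C.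
Proof. by case: z => a b; simpc; congr (_ +i* _); rewrite /=; lra. Qed.

Lemma mulJ_Re_ge0 (z : C) : 0 <= Re (z * z^*).
Proof. by case: z => a b; simpc; rewrite /= -!expr2 addr_ge0 // sqr_ge0. Qed.

Lemma overlap_ge0 U V i j : 0 <= overlap U V i j.
Proof. exact: mulJ_Re_ge0. Qed.

Lemma overlap_mulJ U V i j : (overlap U V i j)%:C = (U^t* *m V) i j * ((U^t* *m V) i j)^*.
Proof. by rewrite [RHS]mulJ_Re. Qed.

Lemma specmx_quad (v : 'cV[C]_d) U l :
  (v^t* *m specmx U l *m v) 0 0 = (specqf U l v)%:C.
Proof.
rewrite /specqf /specmx !mulmxA -(mulmxA _ _ v) -{1}[v^t* *m U]trmxCK adjmxM trmxCK.
set x := U^t* *m v; rewrite mxE rmorph_sum; apply: eq_bigr => k _.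
rewrite mul_mx_diag !mxE rmorphM /= -mulJ_Re; by rewrite mulrAC mulrC [_^* * _]mulrC.
Qed.

Lemma overlap_col U V i j : (U^t* *m col j V) i 0 = (U^t* *m V) i j.
Proof. by rewrite !mxE; apply: eq_bigr => k _; rewrite !mxE. Qed.

Lemma diag_quad V (X : 'M[C]_d) j : (V^t* *m X *m V) j j = ((col j V)^t* *m X *m col j V) 0 0.
Proof.
rewrite !mxE; apply: eq_bigr => k _; rewrite !mxE; congr (_ * _).
by apply: eq_bigr => i _; rewrite !mxE.
Qed.

Lemma specmx_pinch U V l j : (V^t* *m specmx U l *m V) j j = (pinch U V l j)%:C.
Proof.
rewrite diag_quad specmx_quad; congr (_%:C); apply: eq_bigr => i _.
by rewrite /overlap overlap_col mulrC.
Qed.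

Lemma specmx_conj V l : V *m V^t* = 1%:M -> V^t* *m specmx V l *m V = rdiag l.
Proof.
by move=> /unitary_adj uV; rewrite /specmx !mulmxA uV mul1mx -mulmxA uV mulmx1.
Qed.

Lemma mxtrace_conj V (X : 'M[C]_d) : V *m V^t* = 1%:M -> \tr X = \tr (V^t* *m X *m V).
Proof. by move=> uV; rewrite -mulmxA mxtrace_mulC -mulmxA uV mulmx1. Qed.

(** Conjugation by V makes the second factor diagonal, so only the diagonal of the first one in that
    basis enters. *)
Lemma specmx_traceM U V a c : V *m V^t* = 1%:M ->
  \tr (specmx U a *m specmx V c) = (\sum_i \sum_j overlap U V i j * (a i * c j))%:C.
Proof.
move=> uV; rewrite (mxtrace_conj _ uV).
have -> : V^t* *m (specmx U a *m specmx V c) *m V = (V^t* *m specmx U a *m V) *m rdiag c.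
  rewrite -(specmx_conj c uV); move: (specmx U a) (specmx V c) => A B.
  by rewrite !mulmxA -(mulmxA _ V) uV mulmx1.
rewrite exchange_big /= /mxtrace rmorph_sum; apply: eq_bigr => j _.
rewrite mul_mx_diag mxE specmx_pinch !mxE -rmorphM /pinch mulr_suml; congr (_%:C).
by apply: eq_bigr => i _; rewrite mulrA.
Qed.

(** The product of U^t* and V is unitary. With [overlap_suml], the overlaps form a doubly stochastic
    matrix. *)
Lemma overlap_sumr U V i : U *m U^t* = 1%:M -> V *m V^t* = 1%:M -> \sum_j overlap U V i j = 1.
Proof.
move=> uU uV; apply: complexI; rewrite rmorph_sum /=.
have <- : ((U^t* *m V) *m (U^t* *m V)^t*) i i = 1%:C.
  by rewrite adjmxM trmxCK mulmxA -(mulmxA _ V) uV mulmx1 (unitary_adj uU) mxE eqxx.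
rewrite mxE; apply: eq_bigr => j _; rewrite overlap_mulJ; congr (_ * _).
by rewrite [RHS]mxE [(_^T) _ _]mxE.
Qed.

Lemma overlap_sym U V i j : overlap U V i j = overlap V U j i.
Proof.
rewrite /overlap; have -> : (V^t* *m U) j i = ((U^t* *m V) i j)^*.
  by rewrite -[V^t* *m U]trmxCK adjmxM trmxCK [LHS]mxE [(_^T) _ _]mxE.
by rewrite conjCK mulrC.
Qed.

Lemma overlap_suml U V j : U *m U^t* = 1%:M -> V *m V^t* = 1%:M -> \sum_i overlap U V i j = 1.
Proof.
by move=> uU uV; rewrite -(overlap_sumr j uV uU); apply: eq_bigr => i _; exact: overlap_sym.
Qed.

(** Functional calculus does not depend on the diagonalisation. The matrix X = U^t* V intertwines
    the two diagonals, so X i j <> 0 forces l i = m j, hence f (l i) = f (m j). This makes both the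
    entropy and the square root well defined. *)
Lemma specmx_fun U V l m (f : R -> R) : U *m U^t* = 1%:M -> V *m V^t* = 1%:M ->
  specmx U l = specmx V m -> specmx U (fun i => f (l i)) = specmx V (fun i => f (m i)).
Proof.
move=> uU uV e.
have key g h : specmx U g = specmx V h <-> rdiag g *m (U^t* *m V) = (U^t* *m V) *m rdiag h.
  split=> [E|E].
    have := congr1 (fun X => U^t* *m X *m V) E; rewrite /specmx !mulmxA (unitary_adj uU) mul1mx.
    by move=> ->; rewrite -[LHS]mulmxA (unitary_adj uV) mulmx1.
  have := congr1 (fun X => U *m X *m V^t*) E; rewrite /specmx !mulmxA uU mul1mx.
  by move=> <-; rewrite -[RHS]mulmxA uV mulmx1.
move/key: e => e; apply/key; move: (U^t* *m V) e => X e; apply/matrixP => i j.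
move/matrixP/(_ i j): e; rewrite !mul_diag_mx !mul_mx_diag !mxE.
have [->|z0] := eqVneq (X i j) 0; first by rewrite !mulr0 !mul0r.
by rewrite mulrC => /(mulfI z0) /complexI ->; exact: mulrC.
Qed.

Lemma hermitian_specmx (A : 'M[C]_d) : A^t* = A -> exists U l, U *m U^t* = 1%:M /\ A = specmx U l.
Proof.
move=> hA; have HA : A \is hermsymmx.
  by apply/is_hermitianmxP; rewrite expr0 scale1r hA.
have uP := spectral_unitarymx A.
exists ((spectralmx A)^t* ); exists (fun i => Re (spectral_diag A 0 i)); rewrite trmxCK; split.
  by apply: mulmx1C; apply/eqP.
rewrite /specmx trmxCK.
rewrite {1}(orthomx_spectralP (hermitian_normalmx HA)).
rewrite (invmx_unitary uP) /rdiag.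
suff -> : \row_i (Re (spectral_diag A 0 i))%:C = spectral_diag A by [].
apply/rowP => i; rewrite mxE; apply: RRe_real.
by have /mxOverP := hermitian_spectral_diag_real HA; apply.
Qed.

Lemma tr_sqr_ge0 (X : 'M[C]_d) : X^t* = X -> 0 <= Re (\tr (X *m X)).
Proof.
move=> hX; rewrite -{2}hX /mxtrace raddf_sum sumr_ge0 // => i _.
rewrite mxE raddf_sum sumr_ge0 // => j _; rewrite !mxE; exact: mulJ_Re_ge0.
Qed.

End Spectral.

(** * Operator inequalities in trace form *)

Section PositiveMatrices.
Variable d : nat.
Implicit Types (U V : 'M[C]_d) (l m : 'I_d -> R).

(* Tr rho^2 sigma^-1 <= 2 Tr rho whenever rho <= 2 sigma; the hypothesis is tested on the
   vector sigma^-1 u_i for each eigenvector u_i of rho. *)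
Lemma sum_chi2_le U V l m :
  U *m U^t* = 1%:M -> V *m V^t* = 1%:M -> (forall i, 0 <= l i) -> (forall j, 0 <= m j) ->
  (forall v, specqf U l v <= 2 * specqf V m v) ->
  \sum_i \sum_j overlap U V i j * (l i ^+ 2 / m j) <= 2 * \sum_i l i.
Proof.
move=> uU uV l0 m0 dom; rewrite mulr_sumr; apply: ler_sum => i _.
pose s := \sum_j overlap U V i j / m j.
have -> : \sum_j overlap U V i j * (l i ^+ 2 / m j) = l i ^+ 2 * s.
  by rewrite /s mulr_sumr; apply: eq_bigr => j _; rewrite mulrCA.
have s0 : 0 <= s.
  by apply: sumr_ge0 => j _; rewrite divr_ge0 ?overlap_ge0.
pose X := U^t* *m V.
(* Coordinates of the test vector in the basis V. The inverse of 0 is 0, so this is the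
   pseudo-inverse of sigma applied to u_i, and [s] is its pairing with u_i. *)
pose g : 'cV[C]_d := \col_j ((X i j)^* * (m j)^-1%:C).
have Vg : V^t* *m (V *m g) = g by rewrite mulmxA (unitary_adj uV) mul1mx.
have Ug : (U^t* *m (V *m g)) i 0 = s%:C.
  rewrite mulmxA -/X mxE rmorph_sum; apply: eq_bigr => j _.
  by rewrite rmorphM /= overlap_mulJ -/X [g _ _]mxE mulrA.
have := dom (V *m g); rewrite /specqf Vg.
have -> : \sum_j m j * Re (g j 0 * (g j 0)^*) = s.
  apply: eq_bigr => j _.
  have -> : Re (g j 0 * (g j 0)^*) = overlap U V i j * (m j)^-1 ^+ 2.
    rewrite /overlap -/X [g _ _]mxE; case: (X i j) => a b; move: (m j)^-1 => t; simpc.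
    by rewrite /=; ring.
  have [->|mj] := eqVneq (m j) 0; first by rewrite invr0 mul0r mulr0.
  by rewrite mulrCA expr2 mulVKf.
(* Of the nonnegative terms on the left only the one for the eigenvector u_i is kept: l_i s^2 <= 2
   s, hence l_i s <= 2. *)
rewrite (bigD1 i) //= Ug.
have -> : Re (s%:C * (s%:C)^*) = s ^+ 2 by simpc; rewrite /=; ring.
move=> H.
have {}H : l i * s ^+ 2 <= 2 * s.
  apply: le_trans H; rewrite lerDl; apply: sumr_ge0 => k _.
  by apply: mulr_ge0; rewrite ?mulJ_Re_ge0.
have ls : l i * s <= 2.
  have [->|sn] := eqVneq s 0; first by rewrite mulr0.
  have s_gt0 : 0 < s by rewrite lt_def sn.
  by rewrite -(ler_pM2r s_gt0) -mulrA -expr2.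
by rewrite expr2 -mulrA mulrC; apply: ler_wpM2r.
Qed.

Lemma specqf_ge0 U l v : (forall i, 0 <= l i) -> 0 <= specqf U l v.
Proof.
by move=> l0; apply: sumr_ge0 => k _; apply: mulr_ge0; rewrite ?mulJ_Re_ge0.
Qed.

Lemma pinch_ge0 U V l j : (forall i, 0 <= l i) -> 0 <= pinch U V l j.
Proof. by move=> l0; apply: sumr_ge0 => k _; apply: mulr_ge0; rewrite ?overlap_ge0. Qed.

Definition psd (X : 'M[C]_d) := forall v : 'cV[C]_d, 0 <= Re ((v^t* *m X *m v) 0 0).

Lemma psd_specmx U l : (forall i, 0 <= l i) -> psd (specmx U l).
Proof. by move=> l0 v; rewrite specmx_quad; apply: specqf_ge0. Qed.

Lemma psdD X Y : psd X -> psd Y -> psd (X + Y).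
Proof. by move=> pX pY v; rewrite mulmxDr mulmxDl mxE raddfD; apply: addr_ge0; [exact: pX|exact: pY]. Qed.

Lemma psd_sqr X : X^t* = X -> psd (X *m X).
Proof.
move=> hX v; have -> : v^t* *m (X *m X) *m v = (X *m v)^t* *m (X *m v).
  by rewrite adjmxM hX !mulmxA.
rewrite mxE raddf_sum; apply: sumr_ge0 => k _.
by rewrite [(_^t*) _ _]mxE [(_^T) _ _]mxE mulrC; apply: mulJ_Re_ge0.
Qed.

(** If s > c, then x (s + c) is positive, against its value - e <= 0. It is applied to one
    eigenvector of S - K at a time. *)
Lemma scalar_mono (s c e x : R) : 0 <= s -> 0 <= c -> 0 <= e -> x = s - c ->
  x * (s + c) + x * (s + c) = - (e + e) -> x * s <= 0.
Proof.
move=> s0 c0 e0 -> key; have [sc|cs] := lerP s c.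
  by apply: mulr_le0_ge0 => //; rewrite subr_le0.
have : 0 < (s - c) * (s + c) by apply: mulr_gt0; lra.
lra.
Qed.

(* A trace form of the operator monotonicity of the square root:
   in an eigenbasis of S - K its eigenvalues x_k = s_k - c_k satisfy
   x_k (s_k + c_k) = - E_kk <= 0. *)
Lemma tr_sqrt_mono (S K E : 'M[C]_d) :
  S^t* = S -> K^t* = K -> psd S -> psd K -> psd E -> K *m K = S *m S + E ->
  Re (\tr (S *m S)) <= Re (\tr (S *m K)).
Proof.
move=> hS hK pS pK pE KK.
have hX : (S - K)^t* = S - K.
  by rewrite -[in RHS]hS -[in RHS]hK; apply/matrixP => i j; rewrite !mxE rmorphB.
have [Q [x [uQ XE]]] := hermitian_specmx hX.
pose dgl (Y : 'M[C]_d) k := Re ((Q^t* *m Y *m Q) k k).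
have dgl_ge0 Y k : psd Y -> 0 <= dgl Y k by move=> pY; rewrite /dgl diag_quad.
have dglD Y Z k : dgl (Y + Z) k = dgl Y k + dgl Z k.
  by rewrite /dgl mulmxDr mulmxDl mxE raddfD.
have dglN Y k : dgl (- Y) k = - dgl Y k.
  by rewrite /dgl mulmxN mulNmx mxE raddfN.
have dX k : dgl (S - K) k = x k.
  by rewrite /dgl XE specmx_conj // /rdiag !mxE eqxx.
(* In an eigenbasis of S - K, multiplication by S - K on either side scales the k-th diagonal entry
   by x k. *)
have dXl Y k : dgl ((S - K) *m Y) k = x k * dgl Y k.
  rewrite /dgl; have -> : Q^t* *m ((S - K) *m Y) *m Q = rdiag x *m (Q^t* *m Y *m Q).
    rewrite -(specmx_conj x uQ) -XE; move: (S - K) => Z.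
    by rewrite !mulmxA -(mulmxA _ Q) uQ mulmx1.
  by rewrite mul_diag_mx [LHS]/= mxE [X in X * _]mxE; case: ((Q^t* *m Y *m Q) k k) => a b; simpc.
have dXr Y k : dgl (Y *m (S - K)) k = x k * dgl Y k.
  rewrite /dgl; have -> : Q^t* *m (Y *m (S - K)) *m Q = (Q^t* *m Y *m Q) *m rdiag x.
    rewrite -(specmx_conj x uQ) -XE; move: (S - K) => Z.
    transitivity (Q^t* *m Y *m (Q *m Q^t*) *m Z *m Q); last by rewrite !mulmxA.
    by rewrite uQ mulmx1 !mulmxA.
  by rewrite mul_mx_diag mxE [X in _ * X]mxE mulrC; case: ((Q^t* *m Y *m Q) k k) => a b; simpc.
have -> : S *m K = S *m S - S *m (S - K) by rewrite mulmxBr subKr.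
rewrite [\tr (_ - _)]raddfB [Re (_ - _)]raddfB /= lerDl oppr_ge0.
rewrite (mxtrace_conj _ uQ) /mxtrace raddf_sum; apply: sumr_le0 => k _.
change (dgl (S *m (S - K)) k <= 0); rewrite dXr.
have e0 := dgl_ge0 _ k pE; have s0 := dgl_ge0 _ k pS; have c0 := dgl_ge0 _ k pK.
have xE : x k = dgl S k - dgl K k by rewrite -dX dglD dglN.
(* S and K need not commute, so the difference of squares is symmetrised: (S - K)(S + K) + (S + K)(S
   - K) = 2 (S^2 - K^2) = -2 E, where the mixed products cancel. *)
have key : x k * (dgl S k + dgl K k) + x k * (dgl S k + dgl K k) = - (dgl E k + dgl E k).
  rewrite -dglD -{1}dXl -dXr -!dglD -dglN.
  suff -> : (S - K) *m (S + K) + (S + K) *m (S - K) = - (E + E) by [].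
  have -> : E = K *m K - S *m S by rewrite KK addrC addKr.
  rewrite mulmxBl mulmxBr !mulmxDr !mulmxDl.
  move: (S *m S) (S *m K) (K *m S) (K *m K) => A B A' B'.
  by apply/matrixP => i j; rewrite !mxE; ring.
exact: (scalar_mono s0 c0 e0 xE).
Qed.

End PositiveMatrices.

(** * Relative entropy as a sum over pairs of eigenvectors *)

Lemma relent_term_ge_sub (l m : R) : 0 <= l -> 0 <= m -> (m = 0 -> l = 0) ->
  l - m <= l * ln l - l * ln m.
Proof. by move=> /RleP l0 /RleP m0 lm; apply/RleP; exact: kl_ge_sub. Qed.

Lemma relent_term_ge_sqrt (l m : R) : 0 <= l -> 0 <= m -> (m = 0 -> l = 0) ->
  l * ln 2 + 2 * l - 2 * sqrt 2 * (sqrt l * sqrt m) <= l * ln l - l * ln m.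
Proof. by move=> /RleP l0 /RleP m0 lm; apply/RleP; exact: kl_ge_sqrt. Qed.

Lemma relent_term_le_chi2 (l m : R) : 0 <= l -> 0 <= m -> (m = 0 -> l = 0) ->
  l * ln l - l * ln m <= l * ln 2 + l ^+ 2 / m / 2 - l.
Proof. by move=> /RleP l0 /RleP m0 lm; apply/RleP; exact: kl_le_chi2. Qed.

Lemma relent_term_le_hellinger (e l m : R) : 0 <= l -> 0 <= m -> (m = 0 -> l = 0) -> 0 < e ->
  l * ln l - l * ln m <= (sqrt l - sqrt m) ^+ 2 / e + e * (l ^+ 2 / m).
Proof. by move=> /RleP l0 /RleP m0 lm /RltP e0; apply/RleP; exact: kl_le_hellinger. Qed.

Lemma sqrt_sqr (x : R) : 0 <= x -> sqrt x * sqrt x = x.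
Proof. by move=> /RleP; exact: R_sqrt.sqrt_sqrt. Qed.

Lemma sqrt_ge0 (x : R) : 0 <= sqrt x.
Proof. by apply/RleP; exact: R_sqrt.sqrt_pos. Qed.

Section RelEnt.
Variable d : nat.
Variables (U V : 'M[C]_d) (l m : 'I_d -> R).
Hypotheses (uU : U *m U^t* = 1%:M) (uV : V *m V^t* = 1%:M).
Hypotheses (l0 : forall i, 0 <= l i) (m0 : forall j, 0 <= m j).
Hypotheses (l1 : \sum_i l i = 1) (m1 : \sum_j m j = 1).
Hypothesis hm : forall j, pinch U V l j <= 2 * m j.

(* The relative entropy of rho = specmx U l and sigma = specmx V m, as that of the
   distributions overlap * l and overlap * m on pairs of eigenvectors. *)
Definition relent := \sum_i \sum_j overlap U V i j * (l i * ln (l i) - l i * ln (m j)).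
Definition bhatt_sum := \sum_i \sum_j overlap U V i j * (sqrt (l i) * sqrt (m j)).

Lemma sum_overlap_l (f : R -> R) : \sum_i \sum_j overlap U V i j * f (l i) = \sum_i f (l i).
Proof. by apply: eq_bigr => i _; rewrite -mulr_suml overlap_sumr // mul1r. Qed.

Lemma sum_overlap_m (f : R -> R) : \sum_i \sum_j overlap U V i j * f (m j) = \sum_j f (m j).
Proof. by rewrite exchange_big; apply: eq_bigr => j _; rewrite -mulr_suml overlap_suml // mul1r. Qed.

(** If m j = 0, the nonnegative terms of [pinch U V l j] have sum at most 0, so each vanishes. Pairs
    of weight 0 aside, this supplies the absolute continuity that the scalar inequalities ask
    for. *)
Lemma overlap_support i j : overlap U V i j = 0 \/ (m j = 0 -> l i = 0).
Proof.
have [->|n0] := eqVneq (overlap U V i j) 0; [by left|right => mj].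
have := hm j; rewrite /pinch mj mulr0 (bigD1 i) //= => H.
have H1 : 0 <= \sum_(k < d | k != i) overlap U V k j * l k.
  by apply: sumr_ge0 => k _; rewrite mulr_ge0 ?overlap_ge0.
have /eqP : overlap U V i j * l i = 0.
  apply: le_anti; rewrite mulr_ge0 ?overlap_ge0 // andbT.
  by apply: le_trans H; rewrite lerDl.
by rewrite mulf_eq0 (negPf n0) => /eqP.
Qed.

Lemma relent_ge_sum (g : R -> R -> R) :
  (forall i j, (m j = 0 -> l i = 0) -> g (l i) (m j) <= l i * ln (l i) - l i * ln (m j)) ->
  \sum_i \sum_j overlap U V i j * g (l i) (m j) <= relent.
Proof.
move=> H; apply: ler_sum => i _; apply: ler_sum => j _.
case: (overlap_support i j) => [->|s]; first by rewrite !mul0r.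
by apply: ler_wpM2l; [exact: overlap_ge0 | exact: H].
Qed.

Lemma relent_le_sum (g : R -> R -> R) :
  (forall i j, (m j = 0 -> l i = 0) -> l i * ln (l i) - l i * ln (m j) <= g (l i) (m j)) ->
  relent <= \sum_i \sum_j overlap U V i j * g (l i) (m j).
Proof.
move=> H; apply: ler_sum => i _; apply: ler_sum => j _.
case: (overlap_support i j) => [->|s]; first by rewrite !mul0r.
by apply: ler_wpM2l; [exact: overlap_ge0 | exact: H].
Qed.

Lemma relent_ge0 : 0 <= relent.
Proof.
apply: le_trans (relent_ge_sum (g := fun a b => a - b) _); last first.
  by move=> i j s; exact: relent_term_ge_sub.
under eq_bigr do (under eq_bigr do rewrite mulrBr; rewrite sumrB); rewrite sumrB.
by rewrite (sum_overlap_l id) (sum_overlap_m id) l1 m1 subrr.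
Qed.

Lemma relent_ge_bhatt : ln 2 + 2 - 2 * sqrt 2 * bhatt_sum <= relent.
Proof.
apply: le_trans (relent_ge_sum (g := fun a b => a * ln 2 + 2 * a - 2 * sqrt 2 * (sqrt a * sqrt b)) _); last first.
  by move=> i j s; exact: relent_term_ge_sqrt.
under eq_bigr do (under eq_bigr do rewrite mulrBr [overlap _ _ _ _ * (_ * (_ * _))]mulrCA; rewrite sumrB -mulr_sumr); rewrite sumrB -mulr_sumr.
rewrite (sum_overlap_l (fun a => a * ln 2 + 2 * a)) big_split /= -mulr_suml -mulr_sumr l1.
by rewrite mul1r mulr1.
Qed.

Hypothesis chi : \sum_i \sum_j overlap U V i j * (l i ^+ 2 / m j) <= 2.

(** The tangent at ratio 2 leaves ln 2 plus half the chi-squared sum minus 1, and the value 2 in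
    [chi] makes the remainder at most 0. *)
Lemma relent_le_ln2 : relent <= ln 2.
Proof.
apply: (le_trans (relent_le_sum (g := fun a b => a * ln 2 + a ^+ 2 / b / 2 - a) _)).
  by move=> i j s; exact: relent_term_le_chi2.
have -> : \sum_i \sum_j overlap U V i j * (l i * ln 2 + l i ^+ 2 / m j / 2 - l i) =
   \sum_i \sum_j overlap U V i j * (l i * ln 2 - l i) +
   (\sum_i \sum_j overlap U V i j * (l i ^+ 2 / m j)) / 2.
  rewrite mulr_suml -big_split; apply: eq_bigr => i _ /=.
  rewrite mulr_suml -big_split; apply: eq_bigr => j _ /=.
  by rewrite -[X in _ = _ + X]mulrA -mulrDr addrAC.
rewrite (sum_overlap_l (fun a => a * ln 2 - a)) sumrB -mulr_suml l1 mul1r.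
rewrite -[leRHS]addr0 -addrA lerD2l.
move: chi; lra.
Qed.

(** Both distributions on pairs have total mass 1, so the squared differences of roots sum to 2 - 2
    [bhatt_sum]; [chi] bounds the other term by 2 e. *)
Lemma relent_le_bhatt (e : R) : 0 < e -> relent <= (2 - 2 * bhatt_sum) / e + 2 * e.
Proof.
move=> e0.
apply: (le_trans (relent_le_sum (g := fun a b => (sqrt a - sqrt b) ^+ 2 / e + e * (a ^+ 2 / b)) _)).
  by move=> i j s; exact: relent_term_le_hellinger.
have -> : \sum_i \sum_j overlap U V i j * ((sqrt (l i) - sqrt (m j)) ^+ 2 / e + e * (l i ^+ 2 / m j)) =
   (\sum_i \sum_j overlap U V i j * l i + \sum_i \sum_j overlap U V i j * m j - 2 * bhatt_sum) / e +
   e * (\sum_i \sum_j overlap U V i j * (l i ^+ 2 / m j)).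
  rewrite -big_split /= /bhatt_sum mulr_sumr -sumrB mulr_suml mulr_sumr -big_split.
  apply: eq_bigr => i _ /=.
  rewrite -big_split /= !mulr_sumr -sumrB mulr_suml -big_split; apply: eq_bigr => j _ /=.
  move: (l i ^+ 2 / m j) (sqrt_sqr (l0 i)) (sqrt_sqr (m0 j)) => t.
  by move: (sqrt (l i)) (sqrt (m j)) (overlap U V i j) e^-1 => a b w f <- <-; ring.
rewrite (sum_overlap_l id) (sum_overlap_m id) l1 m1 lerD2l mulrC ler_pM2r //.
Qed.
End RelEnt.

(** * Traces of the roots of two states and of their average *)

Lemma ReD (x y : C) : Re (x + y) = Re x + Re y.
Proof. by case: x y => [a b] [e f]. Qed.

Lemma tr_sqrD d (S K : 'M[C]_d) :
  Re (\tr ((S + K) *m (S + K)))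
  = Re (\tr (S *m S)) + 2 * Re (\tr (S *m K)) + Re (\tr (K *m K)).
Proof.
rewrite mulmxDl !mulmxDr !mxtraceD (mxtrace_mulC K S) !ReD; ring.
Qed.

Lemma mulmx_parallelogram d (S K : 'M[C]_d) :
  (S + K) *m (S + K) + (S - K) *m (S - K) = (S *m S + K *m K) + (S *m S + K *m K).
Proof.
rewrite mulmxBl !mulmxBr !mulmxDl !mulmxDr.
move: (S *m S) (S *m K) (K *m S) (K *m K) => A B A' B'.
by apply/matrixP => i j; rewrite !mxE; ring.
Qed.

Lemma adjmxD d (S K : 'M[C]_d) : (S + K)^t* = S^t* + K^t*.
Proof. by rewrite linearD map_mxD. Qed.

Lemma adjmxB d (S K : 'M[C]_d) : (S - K)^t* = S^t* - K^t*.
Proof. by rewrite linearB map_mxB. Qed.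

Lemma adjmxZ d (c : R) (S : 'M[C]_d) : (c%:C *: S)^t* = c%:C *: S^t*.
Proof.
apply/matrixP => i j; rewrite !mxE; case: (S j i) => a b.
by simpc; congr (_ +i* _); rewrite /=; ring.
Qed.

Lemma tr_sqr_expand d (c : R) (S K : 'M[C]_d) :
  Re (\tr ((c%:C *: S - K) *m (c%:C *: S - K)))
  = c * c * Re (\tr (S *m S)) - (c + c) * Re (\tr (S *m K)) + Re (\tr (K *m K)).
Proof.
rewrite mulmxBl !mulmxBr -!scalemxAl -!scalemxAr.
rewrite [\tr _]linearB /= ![\tr (_ - _)]linearB /= !mxtraceZ (mxtrace_mulC K S).
case: (\tr (S *m S)) (\tr (S *m K)) (\tr (K *m K)) => [a b] [e f] [g h].
by simpc; rewrite /=; ring.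
Qed.

Lemma addmxE p q (X Y : 'M[C]_(p, q)) i j : (X + Y) i j = X i j + Y i j.
Proof. by rewrite mxE. Qed.

Lemma Re_half_sum (x y z : C) : x + y = z + z -> Re x + Re y = 2 * Re z.
Proof.
by case: x y z => [a b] [c e] [f g] [-> _] /=; rewrite mulr_natl mulr2n.
Qed.

Section Roots.
Variables (d : nat) (A B K : 'M[C]_d).
Hypotheses (hA : A^t* = A) (hB : B^t* = B) (hK : K^t* = K).
Hypotheses (tA : Re (\tr (A *m A)) = 1) (tB : Re (\tr (B *m B)) = 1) (tK : Re (\tr (K *m K)) = 1).
Let z := Re (\tr (A *m B)).

Lemma tr_sqr_sum : Re (\tr ((A + B) *m (A + B))) = 2 * (1 + z).
Proof. by rewrite tr_sqrD tA tB -/z; ring. Qed.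

(** By the parallelogram law (2K)^2 = (A + B)^2 + (A - B)^2, so [tr_sqrt_mono] compares A + B with
    2K: Tr (A + B)^2 <= 2 Tr (A + B) K, and the left side is 2 (1 + z). *)
Lemma tr_root_avg_ge : psd A -> psd B -> psd K ->
  A *m A + B *m B = K *m K + K *m K -> 1 + z <= Re (\tr ((A + B) *m K)).
Proof.
move=> pA pB pK avg.
have hS : (A + B)^t* = A + B by rewrite adjmxD hA hB.
have hD : (A - B)^t* = A - B by rewrite adjmxB hA hB.
have hKK : (K + K)^t* = K + K by rewrite adjmxD hK.
have KK : (K + K) *m (K + K) = (A + B) *m (A + B) + (A - B) *m (A - B).
  by rewrite mulmx_parallelogram avg mulmxDl mulmxDr.
have := tr_sqrt_mono hS hKK (psdD pA pB) (psdD pK pK) (psd_sqr hD) KK.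
rewrite tr_sqr_sum mulmxDr mxtraceD ReD.
by move: (Re _) z => t y; lra.
Qed.

Lemma tr_root_avg_le : sqrt 2 * Re (\tr ((A + B) *m K)) <= 2 + z.
Proof.
have h2 : sqrt 2 * sqrt 2 = 2 :> R by apply: sqrt_sqr; apply/RleP; exact: RIneq.Rlt_le RIneq.Rlt_0_2.
(* With c = 1/sqrt 2 the matrix c (A + B) - K vanishes when A B = 0, so nonnegativity of the trace
   of its square is sharp at z = 0. *)
pose c := sqrt 2 / 2.
have hX : (c%:C *: (A + B) - K)^t* = c%:C *: (A + B) - K.
  by rewrite adjmxB adjmxZ adjmxD hA hB hK.
have := tr_sqr_ge0 hX; rewrite tr_sqr_expand tr_sqr_sum tK.
have -> : c * c * (2 * (1 + z)) = 1 + z.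
  transitivity ((sqrt 2 * sqrt 2) / 2 * (1 + z)); first by rewrite /c; field.
  by rewrite h2 divff ?mul1r // pnatr_eq0.
have -> : c + c = sqrt 2 by rewrite /c -splitr.
move: (sqrt 2 * _) z => t y; lra.
Qed.

Lemma tr_root_le1 : z <= 1.
Proof.
have hX : (1%:C *: A - B)^t* = 1%:C *: A - B by rewrite scale1r adjmxB hA hB.
have := tr_sqr_ge0 hX; rewrite tr_sqr_expand -/z tA tB.
by move: z => y; lra.
Qed.
End Roots.

(** * Information of a pair of states against its Bhattacharyya parameter *)

Section Channel.
Variable d : nat.
Variables (U0 U1 V : 'M[C]_d) (l0 l1 m : 'I_d -> R).
Hypotheses (u0 : U0 *m U0^t* = 1%:M) (u1 : U1 *m U1^t* = 1%:M) (uV : V *m V^t* = 1%:M).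
Hypotheses (l0p : forall i, 0 <= l0 i) (l1p : forall i, 0 <= l1 i).
Hypotheses (l0s : \sum_i l0 i = 1) (l1s : \sum_i l1 i = 1).
Hypothesis avg : specmx U0 l0 + specmx U1 l1 = specmx V m + specmx V m.

Lemma avg_specqf v : specqf U0 l0 v + specqf U1 l1 v = 2 * specqf V m v.
Proof.
have e U l : specqf U l v = Re ((v^t* *m specmx U l *m v) 0 0) by rewrite specmx_quad.
rewrite !e; apply: Re_half_sum.
transitivity ((v^t* *m (specmx U0 l0 + specmx U1 l1) *m v) 0 0).
  by rewrite mulmxDr mulmxDl addmxE.
by rewrite avg mulmxDr mulmxDl addmxE.
Qed.

Lemma avg_pinch j : pinch U0 V l0 j + pinch U1 V l1 j = 2 * m j.
Proof.
have e U l : pinch U V l j = Re ((V^t* *m specmx U l *m V) j j) by rewrite specmx_pinch.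
have -> : m j = Re ((V^t* *m specmx V m *m V) j j) by rewrite specmx_conj // !mxE eqxx.
rewrite !e; apply: Re_half_sum.
transitivity ((V^t* *m (specmx U0 l0 + specmx U1 l1) *m V) j j).
  by rewrite mulmxDr mulmxDl addmxE.
by rewrite avg mulmxDr mulmxDl addmxE.
Qed.

Lemma avg_spectrum_ge0 j : 0 <= m j.
Proof.
by rewrite -(pmulr_rge0 _ (ltr0Sn _ 1)) -avg_pinch addr_ge0 ?pinch_ge0.
Qed.

Lemma pinch_sum U l : U *m U^t* = 1%:M -> \sum_j pinch U V l j = \sum_i l i.
Proof. by move=> uU; rewrite -(sum_overlap_l l uU uV id) [RHS]exchange_big. Qed.

Lemma avg_spectrum_sum : \sum_j m j = 1.
Proof.
have H : 2 * \sum_j m j = 2 * 1.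
  rewrite mulr_sumr; under eq_bigr do rewrite -avg_pinch.
  by rewrite big_split /= !pinch_sum // l0s l1s mulr1.
by apply: (mulfI _ H); rewrite pnatr_eq0.
Qed.

Lemma pinch_le_l j : pinch U0 V l0 j <= 2 * m j.
Proof. by rewrite -avg_pinch lerDl pinch_ge0. Qed.

Lemma pinch_le_r j : pinch U1 V l1 j <= 2 * m j.
Proof. by rewrite -avg_pinch lerDr pinch_ge0. Qed.

Lemma chi2_le_l : \sum_i \sum_j overlap U0 V i j * (l0 i ^+ 2 / m j) <= 2.
Proof.
apply: (le_trans (sum_chi2_le u0 uV l0p avg_spectrum_ge0 _)); last by rewrite l0s mulr1.
by move=> v; rewrite -avg_specqf lerDl specqf_ge0.
Qed.

Lemma chi2_le_r : \sum_i \sum_j overlap U1 V i j * (l1 i ^+ 2 / m j) <= 2.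
Proof.
apply: (le_trans (sum_chi2_le u1 uV l1p avg_spectrum_ge0 _)); last by rewrite l1s mulr1.
by move=> v; rewrite -avg_specqf lerDr specqf_ge0.
Qed.

(* I(W) in nats *)
Definition jsd :=
  (\sum_i l0 i * ln (l0 i) + \sum_i l1 i * ln (l1 i)) / 2 - \sum_j m j * ln (m j).

(** By [avg_pinch] the diagonals of both states in the eigenbasis of their average have mean m, so
    the two cross terms combine to the sum of m ln m. *)
Lemma jsdE : jsd = (relent U0 V l0 m + relent U1 V l1 m) / 2.
Proof.
have H U (l : 'I_d -> R) : U *m U^t* = 1%:M -> relent U V l m =
    \sum_i l i * ln (l i) - \sum_j pinch U V l j * ln (m j).
  move=> uU; rewrite -(sum_overlap_l l uU uV (fun x => x * ln x)).
  under [X in _ = _ - X]eq_bigr do rewrite /pinch mulr_suml.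
  rewrite [X in _ = _ - X]exchange_big -sumrB; apply: eq_bigr => i _ /=.
  by rewrite -sumrB; apply: eq_bigr => j _ /=; rewrite mulrBr [X in _ - X = _]mulrA.
rewrite (H _ _ u0) (H _ _ u1) addrACA -opprD -[X in (_ - X) / 2]big_split /=.
under [X in (_ - X) / 2]eq_bigr do rewrite -mulrDl avg_pinch -mulrA.
by rewrite -mulr_sumr mulrBl [2 * _]mulrC mulfK // pnatr_eq0.
Qed.

Definition sqrtf (l : 'I_d -> R) i := sqrt (l i).
Local Notation A := (specmx U0 (sqrtf l0)).
Local Notation B := (specmx U1 (sqrtf l1)).
Local Notation K := (specmx V (sqrtf m)).
Definition bhatt_tr := Re (\tr (A *m B)).

Lemma specmx_sqrt_sqr U l : U *m U^t* = 1%:M -> (forall i, 0 <= l i) -> specmx U (sqrtf l) *m specmx U (sqrtf l) = specmx U l.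
Proof.
move=> uU lp; rewrite (specmx_mul _ _ uU) /specmx.
suff -> : rdiag (fun i => sqrtf l i * sqrtf l i) = rdiag l by [].
by congr diag_mx; apply/rowP => i; rewrite !mxE /sqrtf sqrt_sqr.
Qed.

Lemma bhatt_trE : bhatt_tr = \sum_i \sum_j overlap U0 U1 i j * (sqrt (l0 i) * sqrt (l1 j)).
Proof. by rewrite /bhatt_tr specmx_traceM. Qed.

Lemma bhatt_sumE : bhatt_sum U0 V l0 m + bhatt_sum U1 V l1 m = Re (\tr ((A + B) *m K)).
Proof. by rewrite mulmxDl mxtraceD !specmx_traceM. Qed.

Lemma specmx_sqrt_trace U l : U *m U^t* = 1%:M -> (forall i, 0 <= l i) -> \sum_i l i = 1 -> Re (\tr (specmx U (sqrtf l) *m specmx U (sqrtf l))) = 1.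
Proof. by move=> uU lp ls; rewrite specmx_sqrt_sqr // specmx_trace // ls. Qed.

Lemma specmx_sqrt_adj U l : (specmx U (sqrtf l))^t* = specmx U (sqrtf l).
Proof. exact: specmx_adj. Qed.

Lemma psd_specmx_sqrt U l : psd (specmx U (sqrtf l)).
Proof. by apply: psd_specmx => i; exact: sqrt_ge0. Qed.

Lemma tr_roots_ge : 1 + bhatt_tr <= Re (\tr ((A + B) *m K)).
Proof.
apply: (tr_root_avg_ge (specmx_sqrt_adj _ _) (specmx_sqrt_adj _ _) (specmx_sqrt_adj _ _)
  (specmx_sqrt_trace u0 l0p l0s) (specmx_sqrt_trace u1 l1p l1s) (psd_specmx_sqrt _ _) (psd_specmx_sqrt _ _) (psd_specmx_sqrt _ _)).
by rewrite (specmx_sqrt_sqr u0 l0p) (specmx_sqrt_sqr u1 l1p) (specmx_sqrt_sqr uV avg_spectrum_ge0).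
Qed.

Lemma tr_roots_le : sqrt 2 * Re (\tr ((A + B) *m K)) <= 2 + bhatt_tr.
Proof.
exact: (tr_root_avg_le (specmx_sqrt_adj _ _) (specmx_sqrt_adj _ _) (specmx_sqrt_adj _ _)
  (specmx_sqrt_trace u0 l0p l0s) (specmx_sqrt_trace u1 l1p l1s) (specmx_sqrt_trace uV avg_spectrum_ge0 avg_spectrum_sum)).
Qed.

(** The mean of the two bounds is L + 2 - s t, and s t <= 2 + z removes the 2. In [scalar_upper] the
    mean is (2 - t) / e + 2 e, where t >= 1 + z. *)
Lemma scalar_lower (b0 b1 s t z L r0 r1 : R) : b0 + b1 = t -> s * t <= 2 + z ->
  L + 2 - 2 * s * b0 <= r0 -> L + 2 - 2 * s * b1 <= r1 -> L - z <= (r0 + r1) / 2.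
Proof. by move=> <-; rewrite mulrDr; lra. Qed.

Lemma scalar_upper (b0 b1 t z e r0 r1 : R) : b0 + b1 = t -> 1 + z <= t -> 0 < e ->
  r0 <= (2 - 2 * b0) / e + 2 * e -> r1 <= (2 - 2 * b1) / e + 2 * e ->
  (r0 + r1) / 2 <= (1 - z) / e + 2 * e.
Proof.
move=> <- h e0 h0 h1.
have ie : 0 < e^-1 by rewrite invr_gt0.
have : 0 <= (b0 + b1 - (1 + z)) * e^-1 by apply: mulr_ge0; lra.
move: h0 h1; rewrite !mulrBl !mulrDl; lra.
Qed.

Theorem channel_bounds : [/\ 0 <= jsd, jsd <= ln 2, ln 2 - bhatt_tr <= jsd &
  forall e : R, 0 < e -> jsd <= (1 - bhatt_tr) / e + 2 * e].
Proof.
rewrite jsdE; split.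
- rewrite divr_ge0 // addr_ge0 //.
    exact: (relent_ge0 u0 uV l0p avg_spectrum_ge0 l0s avg_spectrum_sum pinch_le_l).
  exact: (relent_ge0 u1 uV l1p avg_spectrum_ge0 l1s avg_spectrum_sum pinch_le_r).
- rewrite ler_pdivrMr // mulr_natr mulr2n lerD //.
    exact: (relent_le_ln2 u0 uV l0p avg_spectrum_ge0 l0s pinch_le_l chi2_le_l).
  exact: (relent_le_ln2 u1 uV l1p avg_spectrum_ge0 l1s pinch_le_r chi2_le_r).
- apply: (scalar_lower bhatt_sumE tr_roots_le).
    exact: (relent_ge_bhatt u0 uV l0p avg_spectrum_ge0 l0s pinch_le_l).
  exact: (relent_ge_bhatt u1 uV l1p avg_spectrum_ge0 l1s pinch_le_r).
- move=> e e0; apply: (scalar_upper bhatt_sumE tr_roots_ge e0).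
    exact: (relent_le_bhatt u0 uV l0p avg_spectrum_ge0 l0s avg_spectrum_sum pinch_le_l chi2_le_l e0).
  exact: (relent_le_bhatt u1 uV l1p avg_spectrum_ge0 l1s avg_spectrum_sum pinch_le_r chi2_le_r e0).
Qed.

Lemma bhatt_tr_ge0 : 0 <= bhatt_tr.
Proof.
rewrite bhatt_trE; apply: sumr_ge0 => i _; apply: sumr_ge0 => j _.
by apply: mulr_ge0; [exact: overlap_ge0 | apply: mulr_ge0; exact: sqrt_ge0].
Qed.

Lemma bhatt_tr_le1 : bhatt_tr <= 1.
Proof.
exact: (tr_root_le1 (specmx_sqrt_adj _ _) (specmx_sqrt_adj _ _) (specmx_sqrt_trace u0 l0p l0s) (specmx_sqrt_trace u1 l1p l1s)).
Qed.

End Channel.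

(** * Transfer between entry functions and finite matrices *)

Definition toC (z : Cx) : C := cre z +i* cim z.
Definition ofC (z : C) : Cx := mkCx (complex.Re z) (complex.Im z).
Definition toM d (A : Mat) : 'M[C]_d := \matrix_(i, j) toC (A i j).
Definition ofM d (X : 'M[C]_d) : Mat := fun i j =>
  if insub i is Some i' then if insub j is Some j' then ofC (X i' j') else Cx0 else Cx0.
Definition ofV d (l : 'I_d -> R) : nat -> R := fun i => if insub i is Some i' then l i' else 0.

Lemma toCK z : ofC (toC z) = z. Proof. by case: z. Qed.
Lemma ofCK z : toC (ofC z) = z. Proof. by case: z. Qed.

Lemma toC_inj : injective toC. Proof. exact: can_inj toCK. Qed.

Lemma toCM a b : toC (Cmul a b) = toC a * toC b. Proof. by []. Qed.
Lemma toCJ a : toC (Cconj a) = (toC a)^*. Proof. by []. Qed.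
Lemma toC_real r : toC (RC r) = r%:C. Proof. by []. Qed.

Lemma Csum_big d f : toC (Csum d f) = \sum_(i < d) toC (f i).
Proof.
elim: d => [|d IH]; first by rewrite big_ord0.
by rewrite big_ord_recr /= -IH.
Qed.

Lemma Rsum_big d f : Rsum d f = \sum_(i < d) f i.
Proof.
elim: d => [|d IH]; first by rewrite big_ord0.
by rewrite big_ord_recr /= -IH.
Qed.

Lemma ofMK d (X : 'M[C]_d) : toM d (ofM X) = X.
Proof.
by apply/matrixP => i j; rewrite !mxE /ofM !valK ofCK.
Qed.

Lemma ofVK d (l : 'I_d -> R) (i : 'I_d) : ofV l i = l i.
Proof. by rewrite /ofV valK. Qed.

Lemma unitaryP d U : Defs.is_unitary d U <-> toM d U *m (toM d U)^t* = 1%:M.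
Proof.
have E (i j : 'I_d) : (toM d U *m (toM d U)^t*) i j
    = toC (Csum d (fun k => Cmul (U i k) (Cconj (U j k)))).
  by rewrite Csum_big mxE; apply: eq_bigr => k _; rewrite !mxE.
split=> H.
  apply/matrixP => i j; rewrite E (H i j (ssrnat.ltP (ltn_ord i)) (ssrnat.ltP (ltn_ord j))) [RHS]mxE.
  have -> : Nat.eqb i j = (i == j) by apply/PeanoNat.Nat.eqb_spec/eqP => [/val_inj|->].
  by case: (i == j).
move=> i j /ssrnat.ltP hi /ssrnat.ltP hj; apply: toC_inj.
rewrite -[LHS](E (Ordinal hi) (Ordinal hj)) H mxE.
have -> : Nat.eqb i j = (Ordinal hi == Ordinal hj).
  by apply/PeanoNat.Nat.eqb_spec/eqP => [e|[]//]; apply: val_inj.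
by case: (_ == _).
Qed.

Lemma toM_eqm d A B : eqm d A B <-> toM d A = toM d B.
Proof.
split=> [H|/matrixP H].
  by apply/matrixP => i j; rewrite !mxE H //; apply/ssrnat.ltP.
move=> i j /ssrnat.ltP hi /ssrnat.ltP hj; apply: toC_inj.
by have := H (Ordinal hi) (Ordinal hj); rewrite !mxE.
Qed.

Lemma toM_conj_diag d U l : toM d (conj_diag d U l) = specmx (toM d U) (fun i : 'I_d => l i).
Proof.
apply/matrixP => i j; rewrite mxE Csum_big /specmx /rdiag mul_mx_diag mxE.
by apply: eq_bigr => k _; rewrite !toCM toCJ toC_real !mxE.
Qed.

Lemma spectrumE d rho l :
  is_spectrum d rho l <-> exists U, Defs.is_unitary d U /\ toM d rho = specmx (toM d U) (fun i : 'I_d => l i).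
Proof.
by split=> -[U [hU H]]; exists U; split=> //; move: H; rewrite -toM_conj_diag -toM_eqm.
Qed.

Lemma hermitianP d A : is_hermitian d A -> (toM d A)^t* = toM d A.
Proof.
move=> H; apply/matrixP => i j; rewrite !mxE; transitivity (toC (Cconj (A j i))) => //.
by congr toC; rewrite (H j i) //; apply/ssrnat.ltP.
Qed.

Lemma spectrum_exists d rho : is_hermitian d rho -> exists l, is_spectrum d rho l.
Proof.
move=> /hermitianP /hermitian_specmx [U [l [uU E]]].
exists (ofV l); apply/spectrumE; exists (ofM U); split; first by apply/unitaryP; rewrite ofMK.
rewrite ofMK E /specmx; congr (_ *m _ *m _).
by rewrite /rdiag; congr diag_mx; apply/rowP => i; rewrite !mxE ofVK.
Qed.

Lemma spectrum_spec d rho : is_hermitian d rho -> is_spectrum d rho (spectrum d rho).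
Proof. by move/spectrum_exists; exact: ClassicalEpsilon.epsilon_spec. Qed.

(** Both sums are the trace of f(rho), which [specmx_fun] shows to be independent of the
    diagonalisation. For f = [xlogx] this makes the choice behind [vN_entropy] harmless. *)
Lemma spectrum_Rsum_unique d rho l m (f : R -> R) :
  is_spectrum d rho l -> is_spectrum d rho m ->
  Rsum d (fun k => f (l k)) = Rsum d (fun k => f (m k)).
Proof.
move=> /spectrumE [U [/unitaryP uU EU]] /spectrumE [V [/unitaryP uV EV]].
rewrite !Rsum_big; apply: complexI.
rewrite -(specmx_trace (fun i : 'I_d => f (l i)) uU) -(specmx_trace (fun i : 'I_d => f (m i)) uV).
by congr (\tr _); apply: (specmx_fun f uU uV); rewrite -EU.
Qed.

Lemma sqrt_unique d rho S T : is_sqrt d rho S -> is_sqrt d rho T -> eqm d S T.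
Proof.
move=> [U [l [/unitaryP uU [_ [/toM_eqm eU /toM_eqm sU]]]]].
move=> [V [m [/unitaryP uV [_ [/toM_eqm eV /toM_eqm sV]]]]].
apply/toM_eqm; rewrite sU sV !toM_conj_diag; apply: (specmx_fun sqrt uU uV).
by rewrite -!toM_conj_diag -eU.
Qed.

Lemma trace_toM d A : \tr (toM d A) = toC (Csum d (fun i => A i i)).
Proof. by rewrite Csum_big; apply: eq_bigr => i _; rewrite mxE. Qed.

Lemma trprod_toM d A B : trprod d A B = Re (\tr (toM d A *m toM d B)).
Proof.
rewrite /trprod; set z := Csum _ _; have -> : cre z = Re (toC z) by case: z.
congr complex.Re; rewrite /z Csum_big; apply: eq_bigr => i _.
by rewrite Csum_big mxE; apply: eq_bigr => j _; rewrite !mxE.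
Qed.

Lemma quad_toM d A v : toC (Csum d (fun i => Csum d (fun j => Cmul (Cmul (Cconj (v i)) (A i j)) (v j))))
  = ((\col_(i < d) toC (v i))^t* *m toM d A *m (\col_(i < d) toC (v i))) 0 0.
Proof.
rewrite Csum_big -mulmxA mxE; apply: eq_bigr => i _.
rewrite Csum_big !mxE mulr_sumr; apply: eq_bigr => j _.
by rewrite !toCM toCJ !mxE mulrA.
Qed.

Lemma psdP d A : is_psd d A <-> psd (toM d A).
Proof.
have E z : cre z = Re (toC z) by case: z.
split=> [H v|H v]; last by apply/RleP; rewrite E quad_toM; exact: H.
have /RleP := H (fun i => if insub i is Some i' then ofC (v i' 0) else Cx0).
rewrite E quad_toM.
set w := \col_(i < d) _; suff -> : w = v by [].
by apply/colP => i; rewrite mxE valK ofCK.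
Qed.

Lemma spectrum_ge0 d rho l k : is_psd d rho -> is_spectrum d rho l -> (k < d)%coq_nat -> Rdefinitions.Rle 0 (l k).
Proof.
move=> /psdP H /spectrumE [U [/unitaryP uU EU]] /ssrnat.ltP hk; apply/RleP.
have := H (col (Ordinal hk) (toM d U)); rewrite EU -diag_quad specmx_conj //.
by rewrite !mxE eqxx.
Qed.

Lemma psd_of_spectrum d rho l : is_spectrum d rho l -> (forall k, (k < d)%coq_nat -> Rdefinitions.Rle 0 (l k)) -> is_psd d rho.
Proof.
move=> /spectrumE [U [/unitaryP uU EU]] H; apply/psdP; rewrite EU; apply: psd_specmx => i.
by apply/RleP/H/ssrnat.ltP.
Qed.

Lemma trace_of_spectrum d rho l : is_spectrum d rho l -> Csum d (fun i => rho i i) = RC (Rsum d l).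
Proof.
move=> /spectrumE [U [/unitaryP uU EU]]; apply: toC_inj.
by rewrite -trace_toM EU specmx_trace // Rsum_big.
Qed.

Lemma sqrt_exists d rho : is_hermitian d rho -> is_psd d rho -> exists S, is_sqrt d rho S.
Proof.
move=> h p; have [l Hl] := spectrum_exists h.
have l0 := spectrum_ge0 p Hl; case: Hl => U [uU E].
by exists (conj_diag d U (fun k => sqrt (l k))); exists U, l.
Qed.

Lemma bhattacharyya_sqrt d rho sigma S T :
  is_sqrt d rho S -> is_sqrt d sigma T -> bhattacharyya d rho sigma = trprod d S T.
Proof.
move=> hS hT.
have /toM_eqm eS : eqm d (msqrt d rho) S.
  by apply: (@sqrt_unique d rho) => //; apply: ClassicalEpsilon.epsilon_spec; exists S.
have /toM_eqm eT : eqm d (msqrt d sigma) T.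
  by apply: (@sqrt_unique d sigma) => //; apply: ClassicalEpsilon.epsilon_spec; exists T.
by rewrite /bhattacharyya !trprod_toM eS eT.
Qed.

Lemma entropy_spectrum d rho l : is_spectrum d rho l -> vN_entropy d rho = Rdefinitions.Ropp (Rsum d (fun k => xlogx (l k))).
Proof.
move=> Hl; rewrite /vN_entropy; congr Rdefinitions.Ropp.
apply: (spectrum_Rsum_unique xlogx _ Hl).
by apply: ClassicalEpsilon.epsilon_spec; exists l.
Qed.

Lemma xlogxE (x : R) : 0 <= x -> xlogx x = x * ln x / ln 2.
Proof.
move=> /RleP x0; rewrite /xlogx /log2; case: RIneq.Rle_dec => h.
  by have -> : x = 0 :> R; [exact: RIneq.Rle_antisym | rewrite !mul0r].
by rewrite -mulrA.
Qed.

Lemma entropy_ln d rho l : is_spectrum d rho l -> (forall k : 'I_d, 0 <= l k) ->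
  vN_entropy d rho = - ((\sum_(k < d) l k * ln (l k)) / ln 2).
Proof.
move=> hl l0; rewrite (entropy_spectrum hl) Rsum_big mulr_suml RoppE; congr (- _).
by apply: eq_bigr => k _; apply: xlogxE.
Qed.

Lemma toM_avg d A B :
  toM d (Mscale (Rdefinitions.Rdiv 1 2) (Madd A B)) + toM d (Mscale (Rdefinitions.Rdiv 1 2) (Madd A B)) = toM d A + toM d B.
Proof.
apply/matrixP => i j; rewrite !mxE !toCM !toC_real.
have -> : toC (Madd A B i j) = toC (A i j) + toC (B i j) by [].
rewrite -mulrDl -rmorphD /= RdivE -splitr mul1r //.
Qed.

Lemma ln2_neq0 : ln 2 != 0.
Proof. by have /RltP := ln2_pos; rewrite lt_def => /andP []. Qed.

Lemma sym_info_bounds d V : is_cq_channel d V ->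
  polar_bounds (sym_info d V) (bhattacharyya d (V false) (V true)).
Proof.
move=> HV; have [h0 [p0 t0]] := HV false; have [h1 [p1 t1]] := HV true.
have [l0 L0] := spectrum_exists h0; have [l1 L1] := spectrum_exists h1.
have [m Lm] := spectrum_exists (hermitian_avg _ _ _ h0 h1).
have l0p (k : 'I_d) : 0 <= l0 k.
  by apply/RleP; apply: (spectrum_ge0 p0 L0); apply/ssrnat.ltP.
have l1p (k : 'I_d) : 0 <= l1 k.
  by apply/RleP; apply: (spectrum_ge0 p1 L1); apply/ssrnat.ltP.
have l0s : \sum_(k < d) l0 k = 1 by move: t0; rewrite (trace_of_spectrum L0) Rsum_big => -[].
have l1s : \sum_(k < d) l1 k = 1 by move: t1; rewrite (trace_of_spectrum L1) Rsum_big => -[].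
have /spectrumE [U0 [U0u E0]] := L0; have /spectrumE [U1 [U1u E1]] := L1.
have /spectrumE [U [Uu E]] := Lm.
have /unitaryP u0 := U0u; have /unitaryP u1 := U1u; have /unitaryP u := Uu.
have avg := toM_avg d (V false) (V true); rewrite E0 E1 E in avg.
have {}avg := esym avg.
have mp := avg_spectrum_ge0 u l0p l1p avg.
have [b1 b2 b3 b4] := channel_bounds u0 u1 u l0p l1p l0s l1s avg.
have zE : bhattacharyya d (V false) (V true)
    = bhatt_tr (toM d U0) (toM d U1) (fun k : 'I_d => l0 k) (fun k : 'I_d => l1 k).
  have S0 : is_sqrt d (V false) (conj_diag d U0 (fun k => sqrt (l0 k))).
    exists U0, l0; split=> //; split; first by move=> k; exact: spectrum_ge0 p0 L0.
    by split=> //; apply/toM_eqm; rewrite E0 toM_conj_diag.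
  have S1 : is_sqrt d (V true) (conj_diag d U1 (fun k => sqrt (l1 k))).
    exists U1, l1; split=> //; split; first by move=> k; exact: spectrum_ge0 p1 L1.
    by split=> //; apply/toM_eqm; rewrite E1 toM_conj_diag.
  by rewrite (bhattacharyya_sqrt S0 S1) trprod_toM !toM_conj_diag.
have iE : sym_info d V * ln 2 = jsd (fun k : 'I_d => l0 k) (fun k : 'I_d => l1 k) (fun k : 'I_d => m k).
  rewrite /sym_info (entropy_ln L0 l0p) (entropy_ln L1 l1p) (entropy_ln Lm mp) /jsd.
  by apply: nats_of_bits; exact/eqP/ln2_neq0.
apply: (polar_bounds_of_nats _ _ _ iE); try exact/RleP; rewrite ?zE.
- exact/RleP.
- by move=> e /RltP e0; apply/RleP; exact: b4.
- by apply/RleP; exact: bhatt_tr_ge0.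
- by apply/RleP; exact: (bhatt_tr_le1 u0 u1 l0p l1p l0s l1s).
Qed.

End Spectral.
Import Spectral.

(** * Complex arithmetic, finite sums and pair indices *)

Lemma Cx_eq (a b : Cx) : cre a = cre b -> cim a = cim b -> a = b.
Proof. destruct a, b; simpl; congruence. Qed.

Lemma Cx_srt : semi_ring_theory Cx0 Cx1 Cadd Cmul (@eq Cx).
Proof. constructor; intros; apply Cx_eq; simpl; ring. Qed.
Add Ring Cx_ring : Cx_srt.

Lemma Cconj_add a b : Cconj (Cadd a b) = Cadd (Cconj a) (Cconj b).
Proof. apply Cx_eq; simpl; ring. Qed.
Lemma Cconj_mul a b : Cconj (Cmul a b) = Cmul (Cconj a) (Cconj b).
Proof. apply Cx_eq; simpl; ring. Qed.
Lemma Cconj_conj a : Cconj (Cconj a) = a.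
Proof. apply Cx_eq; simpl; ring. Qed.
Lemma Cconj_RC r : Cconj (RC r) = RC r.
Proof. apply Cx_eq; simpl; ring. Qed.
Lemma RC_mul r s : RC (r * s) = Cmul (RC r) (RC s).
Proof. apply Cx_eq; simpl; ring. Qed.
Lemma Csum_ext n f g : (forall k, (k < n)%nat -> f k = g k) -> Csum n f = Csum n g.
Proof. induction n; intros H; simpl; [easy|]. rewrite IHn, H; auto. Qed.
Lemma Csum_add n f g : Csum n (fun k => Cadd (f k) (g k)) = Cadd (Csum n f) (Csum n g).
Proof. induction n; simpl; [|rewrite IHn]; ring. Qed.
Lemma Csum_mul_l n c f : Csum n (fun k => Cmul c (f k)) = Cmul c (Csum n f).
Proof. induction n; simpl; [|rewrite IHn]; ring. Qed.
Lemma Csum_mul_r n c f : Csum n (fun k => Cmul (f k) c) = Cmul (Csum n f) c.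
Proof. induction n; simpl; [|rewrite IHn]; ring. Qed.
Lemma Csum_0 n : Csum n (fun _ => Cx0) = Cx0.
Proof. induction n; simpl; [|rewrite IHn]; ring. Qed.
Lemma Csum_swap m n (f : nat -> nat -> Cx) :
  Csum m (fun i => Csum n (f i)) = Csum n (fun j => Csum m (fun i => f i j)).
Proof. induction m; simpl; [now rewrite Csum_0|]. now rewrite IHm, <- Csum_add. Qed.
Lemma Cconj_sum n f : Cconj (Csum n f) = Csum n (fun k => Cconj (f k)).
Proof. induction n; simpl; [apply Cx_eq; simpl; ring|]. now rewrite Cconj_add, IHn. Qed.
Lemma Csum_prod m n f g :
  Csum m (fun i => Csum n (fun j => Cmul (f i) (g j))) = Cmul (Csum m f) (Csum n g).
Proof. rewrite <- Csum_mul_r. apply Csum_ext; intros. apply Csum_mul_l. Qed.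
Lemma Csum_delta n a (f : nat -> Cx) : (a < n)%nat ->
  Csum n (fun k => if Nat.eqb a k then f k else Cx0) = f a.
Proof.
  induction n; intros H; [lia|]. simpl. destruct (Nat.eqb_spec a n) as [->|Hn].
  - rewrite (Csum_ext n _ (fun _ => Cx0)), Csum_0; [ring|].
    intros k Hk. destruct (Nat.eqb_spec n k); [lia|easy].
  - rewrite IHn by lia. ring.
Qed.
Lemma Csum_plus m n f : Csum (m + n) f = Cadd (Csum m f) (Csum n (fun k => f (m + k)%nat)).
Proof.
  induction n; simpl; [rewrite Nat.add_0_r; ring|].
  rewrite Nat.add_succ_r; simpl. rewrite IHn. ring.
Qed.
Lemma Csum_pairs m n f :
  Csum (m * n) f = Csum m (fun a => Csum n (fun b => f (a * n + b)%nat)).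
Proof.
  induction m; [easy|]. rewrite Nat.mul_succ_l, Csum_plus, IHm. reflexivity.
Qed.

Lemma Rsum_ext n f g : (forall k, (k < n)%nat -> f k = g k) -> Rsum n f = Rsum n g.
Proof. induction n; intros H; simpl; [easy|]. rewrite IHn, H; auto. Qed.
Lemma Rsum_add n f g : Rsum n (fun k => f k + g k) = Rsum n f + Rsum n g.
Proof. induction n; simpl; [|rewrite IHn]; ring. Qed.
Lemma Rsum_mul_l n c f : Rsum n (fun k => c * f k) = c * Rsum n f.
Proof. induction n; simpl; [|rewrite IHn]; ring. Qed.
Lemma Rsum_const n c : Rsum n (fun _ => c) = INR n * c.
Proof. induction n; [simpl; ring|]. rewrite S_INR; simpl Rsum; rewrite IHn; ring. Qed.
Lemma Rsum_plus m n f : Rsum (m + n) f = Rsum m f + Rsum n (fun k => f (m + k)%nat).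
Proof.
  induction n; simpl; [rewrite Nat.add_0_r; ring|].
  rewrite Nat.add_succ_r; simpl. rewrite IHn. ring.
Qed.
Lemma Rsum_pairs m n f :
  Rsum (m * n) f = Rsum m (fun a => Rsum n (fun b => f (a * n + b)%nat)).
Proof.
  induction m; [easy|]. rewrite Nat.mul_succ_l, Rsum_plus, IHm. reflexivity.
Qed.

Lemma div_pair a b n : (b < n)%nat -> ((a * n + b) / n = a)%nat.
Proof. intros H. rewrite Nat.div_add_l by lia. rewrite Nat.div_small; lia. Qed.
Lemma mod_pair a b n : (b < n)%nat -> ((a * n + b) mod n = b)%nat.
Proof. intros H. rewrite Nat.add_comm, Nat.Div0.mod_add. now apply Nat.mod_small. Qed.
Lemma pair_lt i m n : (i < m * n)%nat -> (i / n < m /\ i mod n < n)%nat.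
Proof.
  intros H. assert (n <> 0)%nat by (intros ->; lia).
  split; [apply Nat.Div0.div_lt_upper_bound; lia | now apply Nat.mod_upper_bound].
Qed.

Lemma Csum_pair_fun m n (f : nat -> nat -> Cx) :
  Csum (m * n) (fun k => f (k / n)%nat (k mod n)%nat) = Csum m (fun a => Csum n (f a)).
Proof.
  rewrite Csum_pairs. apply Csum_ext; intros a _. apply Csum_ext; intros b Hb.
  now rewrite div_pair, mod_pair.
Qed.
Lemma Rsum_pair_fun m n (f : nat -> nat -> R) :
  Rsum (m * n) (fun k => f (k / n)%nat (k mod n)%nat) = Rsum m (fun a => Rsum n (f a)).
Proof.
  rewrite Rsum_pairs. apply Rsum_ext; intros a _. apply Rsum_ext; intros b Hb.
  now rewrite div_pair, mod_pair.
Qed.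

Lemma eqb_pair i j n : Nat.eqb i j = (Nat.eqb (i / n) (j / n) && Nat.eqb (i mod n) (j mod n))%bool.
Proof.
  destruct (Nat.eqb_spec i j) as [->|H]; [now rewrite !Nat.eqb_refl|].
  destruct (Nat.eqb_spec (i / n) (j / n)) as [E1|]; [|easy].
  destruct (Nat.eqb_spec (i mod n) (j mod n)) as [E2|]; [|easy].
  exfalso; apply H. rewrite (Nat.div_mod_eq i n), (Nat.div_mod_eq j n). congruence.
Qed.

(** * States up to the unused entries *)

Lemma eqm_trans d A B C : eqm d A B -> eqm d B C -> eqm d A C.
Proof. intros H K i j Hi Hj. now rewrite H, K. Qed.

Lemma spectrum_eqm d A B l : eqm d A B -> is_spectrum d A l -> is_spectrum d B l.
Proof.
  intros H (U & HU & E). exists U; split; [easy|]. intros i j Hi Hj.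
  rewrite <- H by easy. now apply E.
Qed.

Lemma entropy_eqm d A B : is_hermitian d A -> eqm d A B -> vN_entropy d A = vN_entropy d B.
Proof.
  intros HA E. destruct (@spectrum_exists d A HA) as [l Hl].
  rewrite (@entropy_spectrum d A l Hl), (@entropy_spectrum d B l); [easy|].
  now apply (spectrum_eqm d A).
Qed.

Lemma density_spectrum d A : is_density d A -> exists l, is_spectrum d A l /\
  (forall k, (k < d)%nat -> 0 <= l k) /\ Rsum d l = 1.
Proof.
  intros (H & P & T). destruct (@spectrum_exists d A H) as [l Hl]. exists l.
  repeat split; [easy | intros; now apply (@spectrum_ge0 d A) |].
  rewrite (@trace_of_spectrum d A l Hl) in T. now injection T.
Qed.

Lemma density_of_spectrum d A l : is_hermitian d A -> is_spectrum d A l ->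
  (forall k, (k < d)%nat -> 0 <= l k) -> Rsum d l = 1 -> is_density d A.
Proof.
  intros H S P T. repeat split; [easy | now apply (@psd_of_spectrum d A l) |].
  rewrite (@trace_of_spectrum d A l S), T. reflexivity.
Qed.

Lemma conj_diag_hermitian d U l : is_hermitian d (conj_diag d U l).
Proof.
  intros i j _ _. unfold conj_diag. rewrite Cconj_sum. apply Csum_ext; intros k _.
  rewrite !Cconj_mul, Cconj_conj, Cconj_RC. ring.
Qed.

Lemma xlogx_mul x y : 0 <= x -> 0 <= y -> xlogx (x * y) = x * xlogx y + y * xlogx x.
Proof.
  intros Hx Hy. unfold xlogx.
  destruct (Rle_dec x 0), (Rle_dec y 0), (Rle_dec (x * y) 0);
    try (replace x with 0 by lra); try (replace y with 0 by lra); try ring; try nra.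
  unfold log2. rewrite ln_mult by lra. unfold Rdiv. ring.
Qed.

(** * Tensor products *)

Lemma kron_unitary dA dB U V :
  is_unitary dA U -> is_unitary dB V -> is_unitary (dA * dB) (kron dB U V).
Proof.
  intros HU HV i j Hi Hj. destruct (pair_lt i dA dB Hi), (pair_lt j dA dB Hj).
  unfold kron.
  rewrite (Csum_pair_fun dA dB (fun a b => Cmul (Cmul (U (i / dB) a) (V (i mod dB) b))
     (Cconj (Cmul (U (j / dB) a) (V (j mod dB) b))))%nat).
  rewrite (Csum_ext dA _ (fun a => Csum dB (fun b =>
    Cmul (Cmul (U (i / dB) a) (Cconj (U (j / dB) a)))
         (Cmul (V (i mod dB) b) (Cconj (V (j mod dB) b)))))%nat).
  2: { intros. apply Csum_ext; intros. rewrite Cconj_mul. ring. }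
  rewrite Csum_prod, HU, HV by easy. rewrite (eqb_pair i j dB).
  destruct (Nat.eqb (i / dB) _), (Nat.eqb (i mod dB) _); simpl; ring.
Qed.

Lemma kron_conj_diag dA dB U V l m :
  eqm (dA * dB) (kron dB (conj_diag dA U l) (conj_diag dB V m))
    (conj_diag (dA * dB) (kron dB U V) (fun k => l (k / dB)%nat * m (k mod dB)%nat)).
Proof.
  intros i j Hi Hj. unfold conj_diag, kron.
  rewrite (Csum_pair_fun dA dB (fun a b => Cmul (Cmul (Cmul (U (i / dB) a) (V (i mod dB) b)) (RC (l a * m b)))
     (Cconj (Cmul (U (j / dB) a) (V (j mod dB) b))))%nat).
  rewrite <- Csum_prod. apply Csum_ext; intros. apply Csum_ext; intros.
  rewrite Cconj_mul, RC_mul. ring.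
Qed.

Lemma kron_eqm dA dB A A' B B' : eqm dA A A' -> eqm dB B B' -> eqm (dA * dB) (kron dB A B) (kron dB A' B').
Proof.
  intros HA HB i j Hi Hj. destruct (pair_lt i dA dB Hi), (pair_lt j dA dB Hj).
  unfold kron. now rewrite HA, HB.
Qed.

Lemma spectrum_kron dA dB A B l m : is_spectrum dA A l -> is_spectrum dB B m ->
  is_spectrum (dA * dB) (kron dB A B) (fun k => l (k / dB)%nat * m (k mod dB)%nat).
Proof.
  intros (U & HU & EU) (V & HV & EV). exists (kron dB U V); split; [now apply kron_unitary|].
  apply (eqm_trans _ _ (kron dB (conj_diag dA U l) (conj_diag dB V m))).
  - now apply kron_eqm.
  - apply kron_conj_diag.
Qed.

Lemma sqrt_kron dA dB A B S T : is_sqrt dA A S -> is_sqrt dB B T ->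
  is_sqrt (dA * dB) (kron dB A B) (kron dB S T).
Proof.
  intros (U & l & HU & Hl & EU & SU) (V & m & HV & Hm & EV & SV).
  exists (kron dB U V), (fun k => l (k / dB)%nat * m (k mod dB)%nat).
  split; [now apply kron_unitary|].
  assert (P : forall k, (k < dA * dB)%nat -> 0 <= l (k / dB)%nat /\ 0 <= m (k mod dB)%nat).
  { intros k Hk. destruct (pair_lt k dA dB Hk). auto. }
  split; [intros k Hk; destruct (P k Hk); nra|]. split.
  - eapply eqm_trans; [now apply kron_eqm; eassumption | apply kron_conj_diag].
  - eapply eqm_trans; [now apply kron_eqm; eassumption|].
    eapply eqm_trans; [apply kron_conj_diag|].
    intros i j Hi Hj. apply Csum_ext; intros k Hk.
    destruct (P k Hk). now rewrite sqrt_mult.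
Qed.

Lemma kron_hermitian dA dB A B : is_hermitian dA A -> is_hermitian dB B ->
  is_hermitian (dA * dB) (kron dB A B).
Proof.
  intros HA HB i j Hi Hj. destruct (pair_lt i dA dB Hi), (pair_lt j dA dB Hj).
  unfold kron. now rewrite Cconj_mul, (HA (i / dB)%nat), (HB (i mod dB)%nat).
Qed.

Lemma density_kron dA dB A B : is_density dA A -> is_density dB B ->
  is_density (dA * dB) (kron dB A B).
Proof.
  intros HA HB. destruct (density_spectrum _ _ HA) as (l & Sl & Pl & Tl).
  destruct (density_spectrum _ _ HB) as (m & Sm & Pm & Tm).
  eapply density_of_spectrum.
  - apply kron_hermitian; [apply HA | apply HB].
  - apply spectrum_kron; eassumption.
  - intros k Hk. destruct (pair_lt k dA dB Hk). apply Rmult_le_pos; auto.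
  - simpl. rewrite (Rsum_pair_fun dA dB (fun a b => l a * m b)).
    rewrite <- Tl. apply Rsum_ext; intros. rewrite Rsum_mul_l, Tm. ring.
Qed.

Lemma entropy_kron dA dB A B : is_density dA A -> is_density dB B ->
  vN_entropy (dA * dB) (kron dB A B) = vN_entropy dA A + vN_entropy dB B.
Proof.
  intros HA HB. destruct (density_spectrum _ _ HA) as (l & Sl & Pl & Tl).
  destruct (density_spectrum _ _ HB) as (m & Sm & Pm & Tm).
  rewrite (@entropy_spectrum _ _ _ (spectrum_kron _ _ _ _ _ _ Sl Sm)),
    (@entropy_spectrum _ _ _ Sl), (@entropy_spectrum _ _ _ Sm).
  rewrite (Rsum_pair_fun dA dB (fun a b => xlogx (l a * m b))).
  rewrite (Rsum_ext dA _ (fun a => Rsum dB (fun b => xlogx (m b)) * l a + xlogx (l a))).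
  - rewrite Rsum_add, Rsum_mul_l, Tl. ring.
  - intros a Ha.
    rewrite (Rsum_ext dB _ (fun b => l a * xlogx (m b) + xlogx (l a) * m b)).
    + rewrite Rsum_add, !Rsum_mul_l, Tm. ring.
    + intros b Hb. rewrite xlogx_mul by auto. ring.
Qed.

Lemma trprod_comm d A B : trprod d A B = trprod d B A.
Proof.
  unfold trprod. rewrite Csum_swap. f_equal. apply Csum_ext; intros.
  apply Csum_ext; intros. ring.
Qed.

(** [trprod] keeps only a real part. Real parts multiply in [trprod_kron] because one of the two
    traces is real. *)
Lemma trprod_hermitian_real d A B : is_hermitian d A -> is_hermitian d B ->
  cim (Csum d (fun i => Csum d (fun j => Cmul (A i j) (B j i)))) = 0.
Proof.
  intros HA HB. set (z := Csum _ _).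
  assert (E : Cconj z = z).
  { unfold z. rewrite Cconj_sum, Csum_swap. apply Csum_ext; intros i Hi.
    rewrite Cconj_sum. apply Csum_ext; intros j Hj.
    rewrite Cconj_mul, <- (HA i j), <- (HB j i) by easy. reflexivity. }
  apply (f_equal cim) in E. simpl in E. lra.
Qed.

Lemma trprod_kron dA dB A B A' B' :
  is_hermitian dA A -> is_hermitian dA A' ->
  trprod (dA * dB) (kron dB A B) (kron dB A' B') = trprod dA A A' * trprod dB B B'.
Proof.
  intros HA HA'. unfold trprod.
  set (z := Csum dA _). set (w := Csum dB _).
  replace (Csum (dA * dB) _) with (Cmul z w).
  - unfold z at 1. simpl. rewrite trprod_hermitian_real by easy. unfold z. ring.
  - unfold kron. rewrite (Csum_pair_fun dA dB (fun a b => Csum (dA * dB) (fun j =>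
      Cmul (Cmul (A a (j / dB)) (B b (j mod dB))) (Cmul (A' (j / dB) a) (B' (j mod dB) b))))%nat).
    unfold z, w. rewrite <- Csum_prod. apply Csum_ext; intros a _. apply Csum_ext; intros b _.
    rewrite <- Csum_prod, <- Csum_pair_fun. apply Csum_ext; intros. ring.
Qed.

Lemma sqrt_hermitian d A S : is_sqrt d A S -> is_hermitian d S.
Proof.
  intros (U & l & _ & _ & _ & E) i j Hi Hj. rewrite !E by easy.
  now apply (conj_diag_hermitian d).
Qed.

Lemma density_sqrt d A : is_density d A -> exists S, is_sqrt d A S.
Proof. intros (H & P & _). now apply sqrt_exists. Qed.

Lemma bhattacharyya_kron dA dB A A' B B' :
  is_density dA A -> is_density dA A' -> is_density dB B -> is_density dB B' ->
  bhattacharyya (dA * dB) (kron dB A B) (kron dB A' B') = bhattacharyya dA A A' * bhattacharyya dB B B'.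
Proof.
  intros HA HA' HB HB'.
  destruct (density_sqrt _ _ HA) as [S HS], (density_sqrt _ _ HA') as [S' HS'],
    (density_sqrt _ _ HB) as [T HT], (density_sqrt _ _ HB') as [T' HT'].
  rewrite (@bhattacharyya_sqrt _ _ _ _ _ HS HS'), (@bhattacharyya_sqrt _ _ _ _ _ HT HT').
  rewrite (@bhattacharyya_sqrt _ _ _ _ _ (sqrt_kron _ _ _ _ _ _ HS HT) (sqrt_kron _ _ _ _ _ _ HS' HT')).
  apply trprod_kron; eapply sqrt_hermitian; eassumption.
Qed.

Lemma bhattacharyya_comm d A B : bhattacharyya d A B = bhattacharyya d B A.
Proof. apply trprod_comm. Qed.

(** * Classical-quantum states *)

(** The block diagonal matrix with blocks [B a] of size [D]: a classical register whose value [a]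
    labels the state. *)
Definition block (n D : nat) (B : nat -> Mat) : Mat :=
  fun i j => if Nat.eqb (i / D) (j / D) then B (i / D)%nat (i mod D)%nat (j mod D)%nat else Cx0.

(** The product of rows i and j of two block matrices. It serves both the unitarity and the spectral
    decomposition in [spectrum_block]. *)
Lemma Csum_block n D i j (F G : nat -> Cx) : (i / D < n)%nat ->
  Csum (n * D) (fun k => Cmul (if Nat.eqb (i / D) (k / D) then F (k mod D)%nat else Cx0)
                              (if Nat.eqb (j / D) (k / D) then G (k mod D)%nat else Cx0))
  = if Nat.eqb (i / D) (j / D) then Csum D (fun b => Cmul (F b) (G b)) else Cx0.
Proof.
  intros Hi.
  rewrite (Csum_pair_fun n D (fun a b => Cmul (if Nat.eqb (i / D) a then F b else Cx0)
                              (if Nat.eqb (j / D) a then G b else Cx0))).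
  rewrite (Csum_ext n _ (fun a => if Nat.eqb (i / D) a then
     (if Nat.eqb (j / D) a then Csum D (fun b => Cmul (F b) (G b)) else Cx0) else Cx0)).
  - rewrite Csum_delta by easy. now rewrite Nat.eqb_sym.
  - intros a _. destruct (Nat.eqb (i / D) a), (Nat.eqb (j / D) a); [easy|..];
      (transitivity (Csum D (fun _ => Cx0)); [apply Csum_ext; intros; ring | apply Csum_0]).
Qed.

Lemma spectrum_block n D (p : R) (B : nat -> Mat) (l : nat -> nat -> R) :
  (forall a, (a < n)%nat -> is_spectrum D (B a) (l a)) ->
  is_spectrum (n * D) (block n D (fun a => Mscale p (B a)))
    (fun k => p * l (k / D)%nat (k mod D)%nat).
Proof.
  intros H.
  (* A choice function needs an existence statement for every [a]; the bound sits inside it, and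
     [Mzero] is a dummy for a >= n. *)
  assert (C : forall a, exists U, (a < n)%nat -> is_unitary D U /\ eqm D (B a) (conj_diag D U (l a))).
  { intros a. destruct (lt_dec a n) as [Ha|Ha]; [|now exists Mzero].
    destruct (H a Ha) as (U & HU). now exists U. }
  set (U := fun a => proj1_sig (constructive_indefinite_description _ (C a))).
  assert (HU : forall a, (a < n)%nat -> is_unitary D (U a) /\ eqm D (B a) (conj_diag D (U a) (l a)))
    by (intros a; unfold U; now destruct constructive_indefinite_description).
  assert (P : forall i k, block n D U i k =
    if Nat.eqb (i / D) (k / D) then U (i / D)%nat (i mod D)%nat (k mod D)%nat else Cx0) by easy.
  exists (block n D U). split; intros i j Hi Hj;
    destruct (pair_lt i n D Hi) as [Hi1 Hi2], (pair_lt j n D Hj) as [Hj1 Hj2];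
    destruct (HU _ Hi1) as [HUu HUE].
  - rewrite (Csum_ext _ _ (fun k =>
       Cmul (if Nat.eqb (i / D) (k / D) then U (i / D) (i mod D) (k mod D) else Cx0)
            (if Nat.eqb (j / D) (k / D) then Cconj (U (j / D) (j mod D) (k mod D)) else Cx0))%nat).
    + rewrite (Csum_block n D i j (fun b => U (i / D) (i mod D) b)%nat
        (fun b => Cconj (U (j / D) (j mod D) b))%nat) by easy.
      rewrite (eqb_pair i j D). destruct (Nat.eqb_spec (i / D) (j / D)) as [E|]; [|easy].
      rewrite <- E. now apply HUu.
    + intros k _. rewrite !P. destruct (Nat.eqb (j / D) (k / D)); [easy|].
      f_equal. apply Cx_eq; simpl; ring.
  - rewrite (Csum_ext _ _ (fun k =>
       Cmul (if Nat.eqb (i / D) (k / D) then Cmul (U (i / D) (i mod D) (k mod D)) (RC (p * l (i / D) (k mod D))) else Cx0)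
            (if Nat.eqb (j / D) (k / D) then Cconj (U (j / D) (j mod D) (k mod D)) else Cx0))%nat).
    + rewrite (Csum_block n D i j
        (fun b => Cmul (U (i / D) (i mod D) b) (RC (p * l (i / D) b)))%nat
        (fun b => Cconj (U (j / D) (j mod D) b))%nat) by easy.
      unfold block. destruct (Nat.eqb_spec (i / D) (j / D)) as [E|]; [|easy].
      rewrite <- E. unfold Mscale. rewrite HUE by easy. unfold conj_diag.
      rewrite <- Csum_mul_l. apply Csum_ext; intros. rewrite RC_mul. ring.
    + intros k _. rewrite !P.
      destruct (Nat.eqb_spec (i / D) (k / D)) as [E|]; [rewrite E|];
      (destruct (Nat.eqb (j / D) (k / D)); [ring|]);
      replace (Cconj Cx0) with Cx0 by (apply Cx_eq; simpl; ring); ring.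
Qed.

Lemma block_hermitian n D B : (forall a, (a < n)%nat -> is_hermitian D (B a)) ->
  is_hermitian (n * D) (block n D B).
Proof.
  intros H i j Hi Hj. destruct (pair_lt i n D Hi), (pair_lt j n D Hj).
  unfold block. rewrite Nat.eqb_sym. destruct (Nat.eqb_spec (i / D) (j / D)) as [E|].
  - rewrite <- E. now apply H.
  - apply Cx_eq; simpl; ring.
Qed.

Lemma hermitian_scale d p A : is_hermitian d A -> is_hermitian d (Mscale p A).
Proof.
  intros H i j Hi Hj. unfold Mscale. rewrite (H i j), Cconj_mul, Cconj_RC by easy. reflexivity.
Qed.

(** Each block has trace 1, so [xlogx_mul] separates the register from the states. The register
    contributes - log2 p, which cancels in [sym_info_block]. *)
Lemma entropy_block n D p B : 0 < p -> INR n * p = 1 ->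
  (forall a, (a < n)%nat -> is_density D (B a)) ->
  vN_entropy (n * D) (block n D (fun a => Mscale p (B a)))
  = p * Rsum n (fun a => vN_entropy D (B a)) - log2 p.
Proof.
  intros Hp Hn H. set (l := fun a => spectrum D (B a)).
  assert (S : forall a, (a < n)%nat -> is_spectrum D (B a) (l a)).
  { intros a Ha. apply spectrum_spec. now apply H. }
  rewrite (@entropy_spectrum _ _ _ (spectrum_block n D p B l S)).
  rewrite (Rsum_pair_fun n D (fun a b => xlogx (p * l a b))).
  rewrite (Rsum_ext n _ (fun a => (- p) * vN_entropy D (B a) + xlogx p)).
  - rewrite Rsum_add, Rsum_mul_l, Rsum_const. unfold xlogx.
    destruct (Rle_dec p 0); [lra|]. rewrite <- Rmult_assoc, Hn. ring.
  - intros a Ha. destruct (H a Ha) as (HH & HP & HT).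
    rewrite (@trace_of_spectrum _ _ _ (S a Ha)) in HT. injection HT as HT.
    rewrite (@entropy_spectrum _ _ _ (S a Ha)).
    rewrite (Rsum_ext D _ (fun b => p * xlogx (l a b) + xlogx p * l a b)).
    + rewrite Rsum_add, !Rsum_mul_l, HT. ring.
    + intros b Hb. rewrite xlogx_mul; [ring | lra |].
      exact (@spectrum_ge0 _ _ _ _ HP (S a Ha) Hb).
Qed.

Definition Mavg (A B : Mat) : Mat := Mscale (1/2) (Madd A B).

Lemma density_avg d A B : is_density d A -> is_density d B -> is_density d (Mavg A B).
Proof.
  intros (H & P & T) (H' & P' & T'). repeat split.
  - now apply hermitian_avg.
  - intros v. specialize (P v). specialize (P' v).
    rewrite (Csum_ext d _ (fun i => Cmul (RC (1/2)) (Cadd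
      (Csum d (fun j => Cmul (Cmul (Cconj (v i)) (A i j)) (v j)))
      (Csum d (fun j => Cmul (Cmul (Cconj (v i)) (B i j)) (v j)))))).
    + rewrite Csum_mul_l, Csum_add. simpl. lra.
    + intros i _. rewrite <- Csum_add, <- Csum_mul_l. apply Csum_ext; intros.
      unfold Mavg, Mscale, Madd. ring.
  - unfold Mavg, Mscale, Madd. rewrite Csum_mul_l, Csum_add, T, T'. apply Cx_eq; simpl; lra.
Qed.

Lemma sym_info_block n D p (V : nat -> bool -> Mat) : 0 < p -> INR n * p = 1 ->
  (forall a, (a < n)%nat -> is_cq_channel D (V a)) ->
  sym_info (n * D) (fun x => block n D (fun a => Mscale p (V a x)))
  = p * Rsum n (fun a => sym_info D (V a)).
Proof.
  intros Hp Hn H. unfold sym_info.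
  rewrite !entropy_block by (try easy; intros; now apply H).
  rewrite <- (entropy_eqm (n * D) (block n D (fun a => Mscale p (Mavg (V a false) (V a true))))).
  - rewrite entropy_block by (try easy; intros; apply density_avg; now apply H).
    rewrite (Rsum_ext n (fun a => vN_entropy D (Mscale (1/2) (Madd (V a false) (V a true)))
        - 1/2 * vN_entropy D (V a false) - 1/2 * vN_entropy D (V a true))
      (fun a => vN_entropy D (Mavg (V a false) (V a true))
        + (-(1/2) * vN_entropy D (V a false) + -(1/2) * vN_entropy D (V a true))))
      by (intros; unfold Mavg; ring).
    rewrite !Rsum_add, !Rsum_mul_l. field.
  - apply block_hermitian. intros a Ha. apply hermitian_scale, hermitian_avg; now apply H.
  - intros i j Hi Hj. unfold block, Mavg, Mscale, Madd.
    destruct (Nat.eqb _ _); [ring | apply Cx_eq; simpl; ring].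
Qed.

Lemma sym_info_eqm d V V' : (forall x, is_hermitian d (V x)) -> (forall x, eqm d (V x) (V' x)) ->
  sym_info d V = sym_info d V'.
Proof.
  intros H E. unfold sym_info.
  rewrite (entropy_eqm d (V false) (V' false)), (entropy_eqm d (V true) (V' true)) by (easy || apply H).
  rewrite (entropy_eqm d (Mscale _ _) (Mscale (1/2) (Madd (V' false) (V' true)))); [easy|..].
  - apply hermitian_avg; apply H.
  - intros i j Hi Hj. unfold Mscale, Madd. now rewrite !E.
Qed.

(** * Channel splitting in one step *)

(** [V1] and [V2] are the same split channel conditioned on two different prefixes, hence in general
    not equal. *)
Definition minus_channel (D : nat) (V1 V2 : bool -> Mat) : bool -> Mat :=
  fun x => Mavg (kron D (V1 (xorb x false)) (V2 false)) (kron D (V1 (xorb x true)) (V2 true)).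
(** The known bit [x] is a parameter here rather than a register; the average over it is taken in
    [level_plus]. *)
Definition plus_channel (D : nat) (V1 V2 : bool -> Mat) (x : bool) : bool -> Mat :=
  fun y => kron D (V1 (xorb x y)) (V2 y).

(** The state [minus_channel D V1 V2 x] is also the average output of [plus_channel D V1 V2 x], so
    its entropy cancels between the two informations. What remains are entropies of product
    states. *)
Lemma chain_rule d D V1 V2 : is_cq_channel d V1 -> is_cq_channel D V2 ->
  sym_info (d * D) (minus_channel D V1 V2)
  + (sym_info (d * D) (plus_channel D V1 V2 false) + sym_info (d * D) (plus_channel D V1 V2 true)) / 2
  = sym_info d V1 + sym_info D V2.
Proof.
  intros H1 H2.
  assert (E : Mscale (1/2) (Madd (minus_channel D V1 V2 false) (minus_channel D V1 V2 true))
    = kron D (Mavg (V1 false) (V1 true)) (Mavg (V2 false) (V2 true))).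
  { extensionality i; extensionality j.
    unfold minus_channel, kron, Mavg, Mscale, Madd; simpl. ring. }
  unfold sym_info at 1. rewrite E, entropy_kron by now apply density_avg.
  unfold sym_info, plus_channel; simpl xorb. rewrite !entropy_kron by auto.
  unfold minus_channel, Mavg; simpl xorb. field.
Qed.

Lemma bhattacharyya_plus d D V1 V2 : is_cq_channel d V1 -> is_cq_channel D V2 ->
  forall x, bhattacharyya (d * D) (plus_channel D V1 V2 x false) (plus_channel D V1 V2 x true)
  = bhattacharyya d (V1 false) (V1 true) * bhattacharyya D (V2 false) (V2 true).
Proof.
  intros H1 H2 x. unfold plus_channel. rewrite bhattacharyya_kron by auto.
  destruct x; simpl; [|easy]. now rewrite (bhattacharyya_comm d).
Qed.

(** * Averages over bit sequences *)

Definition stream := nat -> bool.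
Definition zeros : stream := fun _ => false.
Definition scons (b : bool) (u : stream) : stream :=
  fun k => match k with O => b | S k' => u k' end.
Definition prepend (k : nat) (u v : stream) : stream :=
  fun j => if Nat.ltb j k then u j else v (j - k)%nat.
Definition evens (u : stream) : stream := fun k => u (2 * k + 1)%nat.
(** The names refer to positions counted from 1. This is the input of the first half, that is u_o
    xor u_e and not u_o alone. *)
Definition odds (u : stream) : stream := fun k => xorb (u (2 * k)%nat) (u (2 * k + 1)%nat).

Section Average.
(** The carrier is abstract because the same reindexing is needed for states and for real
    quantities. The medial law is the midpoint form of exchanging two sums. *)
Variables (T : Type) (mid : T -> T -> T).
Hypothesis mid_comm : forall a b, mid a b = mid b a.
Hypothesis mid_medial : forall a b c d, mid (mid a b) (mid c d) = mid (mid a c) (mid b d).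

(* Bits beyond the first [m] are set to [false] *)
Fixpoint average (m : nat) (g : stream -> T) : T :=
  match m with
  | O => g zeros
  | S m' => mid (average m' (fun u => g (scons false u))) (average m' (fun u => g (scons true u)))
  end.

Lemma average_mid m f g : average m (fun u => mid (f u) (g u)) = mid (average m f) (average m g).
Proof.
  revert f g; induction m; intros; simpl; [easy|]. now rewrite !IHm, mid_medial.
Qed.

Lemma cons_odds b c v : odds (scons b (scons c v)) = scons (xorb b c) (odds v).
Proof.
  extensionality j. destruct j; [easy|]. unfold odds.
  replace (2 * S j)%nat with (S (S (2 * j))) by lia. reflexivity.
Qed.

Lemma cons_evens b c v : evens (scons b (scons c v)) = scons c (evens v).
Proof.
  extensionality j. destruct j; [easy|]. unfold evens.
  replace (2 * S j + 1)%nat with (S (S (2 * j + 1))) by lia. reflexivity.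
Qed.

(** The map (b, c) -> (b xor c, c) permutes the four pairs of bits, so the inputs of the two halves
    are independent and uniform. Each pair gives four averages, regrouped by the commutative and
    medial laws. *)
Lemma average_deinterleave m F :
  average (2 * m) (fun u => F (odds u) (evens u)) = average m (fun v => average m (fun w => F v w)).
Proof.
  revert F; induction m; intros F; [reflexivity|].
  replace (2 * S m)%nat with (S (S (2 * m))) by lia. simpl average.
  assert (E : forall b c, average (2 * m) (fun u => F (odds (scons b (scons c u))) (evens (scons b (scons c u))))
    = average m (fun v => average m (fun w => F (scons (xorb b c) v) (scons c w)))).
  { intros b c. rewrite <- (IHm (fun v w => F (scons (xorb b c) v) (scons c w))).
    f_equal. extensionality u. now rewrite cons_odds, cons_evens. }
  simpl in E. rewrite !E. simpl. rewrite !average_mid.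
  rewrite (mid_comm (average m (fun v => average m (fun w => F (scons true v) (scons false w))))).
  rewrite mid_medial. f_equal. apply mid_comm.
Qed.

Lemma prepend_cons m b u v : prepend (S m) (scons b u) v = scons b (prepend m u v).
Proof. extensionality j. destruct j; reflexivity. Qed.

(** [average] splits off the first bit, whereas the plus step must single out the last known bit,
    the one decoded just before. *)
Lemma average_last m g :
  average (S m) g = average m (fun u =>
    mid (g (prepend m u (scons false zeros))) (g (prepend m u (scons true zeros)))).
Proof.
  revert g; induction m; intros g.
  - simpl. f_equal; f_equal; extensionality j; unfold prepend; simpl; now rewrite Nat.sub_0_r.
  - change (average (S (S m)) g) with
      (mid (average (S m) (fun u => g (scons false u))) (average (S m) (fun u => g (scons true u)))).
    rewrite (IHm (fun u => g (scons false u))), (IHm (fun u => g (scons true u))). simpl.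
    f_equal; f_equal; extensionality u; now rewrite !prepend_cons.
Qed.
End Average.

Lemma average_hom (T T' : Type) mid mid' (h : T -> T') m g :
  (forall a b, h (mid a b) = mid' (h a) (h b)) ->
  h (average T mid m g) = average T' mid' m (fun u => h (g u)).
Proof. intros H. revert g; induction m; intros; simpl; [easy|]. now rewrite H, !IHm. Qed.

Lemma average_ind2 (T T' : Type) mid mid' (P : T -> T' -> Prop) m f g :
  (forall a b c d, P a c -> P b d -> P (mid a b) (mid' c d)) -> (forall u, P (f u) (g u)) ->
  P (average T mid m f) (average T' mid' m g).
Proof. intros H. revert f g; induction m; intros f g K; simpl; auto. Qed.

Definition Cmid (a b : Cx) : Cx := Cmul (RC (1/2)) (Cadd a b).
Definition Rmid (a b : R) : R := (a + b) / 2.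
Local Notation avgC := (average Cx Cmid).
Local Notation avgR := (average R Rmid).
Local Notation avgM := (average Mat Mavg).

Lemma Rmid_comm a b : Rmid a b = Rmid b a.
Proof. unfold Rmid; field. Qed.
Lemma Rmid_medial a b c d : Rmid (Rmid a b) (Rmid c d) = Rmid (Rmid a c) (Rmid b d).
Proof. unfold Rmid; field. Qed.

Lemma avgM_entry m F i j : avgM m F i j = avgC m (fun u => F u i j).
Proof. now apply (average_hom Mat Cx Mavg Cmid (fun A => A i j)). Qed.

Lemma avgM_deinterleave m F :
  avgM (2 * m) (fun u => F (odds u) (evens u)) = avgM m (fun v => avgM m (fun w => F v w)).
Proof.
  apply average_deinterleave; unfold Mavg, Mscale, Madd; intros;
    extensionality i; extensionality j; ring.
Qed.

Lemma kron_avgM D m F G :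
  kron D (avgM m F) (avgM m G) = avgM m (fun v => avgM m (fun w => kron D (F v) (G w))).
Proof.
  rewrite (average_hom Mat Mat Mavg Mavg (fun A => kron D A (avgM m G))).
  - f_equal. extensionality v. apply (average_hom Mat Mat Mavg Mavg (kron D (F v))).
    intros; unfold Mavg, Mscale, Madd, kron; extensionality i; extensionality j; ring.
  - intros; unfold Mavg, Mscale, Madd, kron; extensionality i; extensionality j; ring.
Qed.

Lemma testbit_cons b t : Nat.testbit (t * 2 + Nat.b2n b) = scons b (Nat.testbit t).
Proof.
  extensionality k. rewrite (Nat.mul_comm t 2). destruct k; simpl scons.
  - apply Nat.testbit_0_r.
  - apply Nat.testbit_succ_r.
Qed.

Lemma pow2_inv_S m : / 2 ^ S m = 1/2 * / 2 ^ m.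
Proof. simpl. field. apply pow_nonzero. lra. Qed.

Lemma Csum_average m g :
  Csum (2 ^ m) (fun t => Cmul (RC (/ 2 ^ m)) (g (Nat.testbit t))) = avgC m g.
Proof.
  revert g; induction m; intros g.
  - simpl. replace (Nat.testbit 0) with zeros by (extensionality k; now rewrite Nat.bits_0).
    rewrite Rinv_1. change (RC 1) with Cx1. ring.
  - replace (2 ^ S m)%nat with (2 ^ m * 2)%nat by (simpl; lia).
    rewrite Csum_pairs. cbn [average]. rewrite <- !IHm. unfold Cmid.
    rewrite <- Csum_add, <- Csum_mul_l. apply Csum_ext; intros t _.
    cbn [Csum]. rewrite <- (testbit_cons false), <- (testbit_cons true), pow2_inv_S, RC_mul.
    cbn [Nat.b2n]. ring.
Qed.

Lemma Rsum_average m g :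
  / 2 ^ m * Rsum (2 ^ m) (fun t => g (Nat.testbit t)) = avgR m g.
Proof.
  revert g; induction m; intros g.
  - simpl. replace (Nat.testbit 0) with zeros by (extensionality k; now rewrite Nat.bits_0).
    rewrite Rinv_1. ring.
  - replace (2 ^ S m)%nat with (2 ^ m * 2)%nat by (simpl; lia).
    rewrite Rsum_pairs. cbn [average]. rewrite <- !IHm. unfold Rmid.
    rewrite (Rsum_ext _ _ (fun t => g (scons false (Nat.testbit t)) + g (scons true (Nat.testbit t)))).
    + rewrite Rsum_add, pow2_inv_S. field. apply pow_nonzero; lra.
    + intros t _. cbn [Rsum]. rewrite <- (testbit_cons false), <- (testbit_cons true).
      cbn [Nat.b2n]. ring.
Qed.

(** * The split channels as averages *)

Section Channel.
Variables (d : nat) (W : bool -> Mat).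
Hypothesis HW : is_cq_channel d W.

(* The paper's index is i = k + 1: the first [k] bits of [u] are u_1^{i-1} and x is u_i. *)
Definition cond_state (n k : nat) (u : stream) (x : bool) : Mat :=
  avgM (2 ^ n - S k) (fun v => combined d W n (prepend k u (scons x v))).

Lemma combined_S n w :
  combined d W (S n) w = kron (d ^ (2 ^ n)) (combined d W n (odds w)) (combined d W n (evens w)).
Proof. reflexivity. Qed.

Lemma assign_prepend k a x m : assign (S k) a x m = prepend k (Nat.testbit a) (scons x (Nat.testbit m)).
Proof.
  extensionality j. unfold assign, prepend. replace (S k - 1)%nat with k by lia.
  destruct (Nat.ltb_spec j k) as [|H]; [easy|].
  destruct (Nat.eqb_spec j k) as [->|H']; [now rewrite Nat.sub_diag|].
  replace (j - k)%nat with (S (j - S k)) by lia. reflexivity.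
Qed.

Lemma Msum_entry m F i j : Msum m F i j = Csum m (fun t => F t i j).
Proof. induction m; simpl; [easy|]. unfold Madd. now rewrite IHm. Qed.

Lemma avg_state_cond n k a x : avg_state d W n (S k) a x = cond_state n k (Nat.testbit a) x.
Proof.
  extensionality i; extensionality j. unfold avg_state, cond_state.
  rewrite Msum_entry, avgM_entry, <- Csum_average. apply Csum_ext; intros t _.
  unfold Mscale. now rewrite assign_prepend.
Qed.

Lemma dim_S n : (d ^ (2 ^ S n) = d ^ (2 ^ n) * d ^ (2 ^ n))%nat.
Proof. rewrite <- Nat.pow_add_r. f_equal. simpl. lia. Qed.

Lemma combined_density n u : is_density (d ^ (2 ^ n)) (combined d W n u).
Proof.
  revert u; induction n; intros u.
  - simpl. rewrite Nat.mul_1_r. apply HW.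
  - rewrite dim_S, combined_S. now apply density_kron.
Qed.

Lemma cond_state_cq n k u : is_cq_channel (d ^ (2 ^ n)) (cond_state n k u).
Proof.
  intros x. unfold cond_state.
  (* Induction for a predicate on one average; the second average is a dummy. *)
  apply (average_ind2 Mat Mat Mavg Mavg (fun A _ => is_density (d ^ (2 ^ n)) A) _ _ (fun _ => Mzero)).
  - intros; now apply density_avg.
  - intros; apply combined_density.
Qed.

Lemma odds_prepend k u v : odds (prepend (2 * k) u v) = prepend k (odds u) (odds v).
Proof.
  extensionality j. unfold odds, prepend.
  destruct (Nat.ltb_spec j k), (Nat.ltb_spec (2 * j) (2 * k)), (Nat.ltb_spec (2 * j + 1) (2 * k)); try lia; try easy.
  f_equal; f_equal; lia.
Qed.

Lemma evens_prepend k u v : evens (prepend (2 * k) u v) = prepend k (evens u) (evens v).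
Proof.
  extensionality j. unfold evens, prepend.
  destruct (Nat.ltb_spec j k), (Nat.ltb_spec (2 * j + 1) (2 * k)); try lia; try easy.
  f_equal; lia.
Qed.

Lemma prepend_last m u v : prepend (S m) u v = prepend m u (scons (u m) v).
Proof.
  extensionality j. unfold prepend.
  destruct (Nat.ltb_spec j (S m)), (Nat.ltb_spec j m); try lia; try easy.
  - replace j with m by lia. now rewrite Nat.sub_diag.
  - replace (j - m)%nat with (S (j - S m)) by lia. reflexivity.
Qed.

(** After the bits x and y an even number of unknown bits is left. They deinterleave into the
    unknown bits of the two halves, and [kron] is affine in each factor. *)
Lemma cond_state_pair n k u x y : (k < 2 ^ n)%nat ->
  avgM (2 ^ S n - S (S (2 * k))) (fun v => combined d W (S n) (prepend (2 * k) u (scons x (scons y v))))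
  = kron (d ^ (2 ^ n)) (cond_state n k (odds u) (xorb x y)) (cond_state n k (evens u) y).
Proof.
  intros Hk. unfold cond_state. rewrite kron_avgM.
  rewrite <- (avgM_deinterleave (2 ^ n - S k) (fun v w => kron (d ^ 2 ^ n)
    (combined d W n (prepend k (odds u) (scons (xorb x y) v)))
    (combined d W n (prepend k (evens u) (scons y w))))).
  replace (2 ^ S n - S (S (2 * k)))%nat with (2 * (2 ^ n - S k))%nat by (simpl; lia).
  f_equal. extensionality v.
  now rewrite combined_S, odds_prepend, evens_prepend, cons_odds, cons_evens.
Qed.

Lemma cond_state_minus n k u : (k < 2 ^ n)%nat ->
  cond_state (S n) (2 * k) u
  = minus_channel (d ^ (2 ^ n)) (cond_state n k (odds u)) (cond_state n k (evens u)).
Proof.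
  intros Hk. extensionality x. unfold minus_channel.
  rewrite <- !cond_state_pair by easy. unfold cond_state.
  (* One more bit is unknown than in [cond_state_pair]; the outermost step of [avgM] averages over
     it, which is the mixture in [minus_channel]. *)
  replace (2 ^ S n - S (2 * k))%nat with (S (2 ^ S n - S (S (2 * k)))) by (simpl; lia).
  reflexivity.
Qed.

Lemma cond_state_plus n k u : (k < 2 ^ n)%nat ->
  cond_state (S n) (2 * k + 1) u
  = plus_channel (d ^ (2 ^ n)) (cond_state n k (odds u)) (cond_state n k (evens u)) (u (2 * k)%nat).
Proof.
  intros Hk. extensionality y. unfold plus_channel.
  rewrite <- !cond_state_pair by easy. unfold cond_state. rewrite Nat.add_1_r.
  f_equal. extensionality v. now rewrite prepend_last.
Qed.

Lemma cond_state_prefix n k u u' : (forall j, (j < k)%nat -> u j = u' j) ->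
  cond_state n k u = cond_state n k u'.
Proof.
  intros H. extensionality x. unfold cond_state. f_equal. extensionality v. f_equal.
  extensionality j. unfold prepend. destruct (Nat.ltb_spec j k); auto.
Qed.

Definition level_info (n k : nat) : R := avgR k (fun u => sym_info (d ^ (2 ^ n)) (cond_state n k u)).
Definition level_bhatt (n k : nat) : R :=
  avgR k (fun u => bhattacharyya (d ^ (2 ^ n)) (cond_state n k u false) (cond_state n k u true)).

(** [split_channel] is a block matrix with equal weights 2^-k, so [sym_info_block] turns the
    register into an average over prefixes. The two matrices agree only on the entries within the
    dimension, hence [sym_info_eqm]. *)
Lemma split_info_level n k : split_info d W n (S k) = level_info n k.
Proof.
  unfold split_info, level_info. rewrite <- Rsum_average, <- sym_info_block.
  - replace (S k - 1)%nat with k by lia. symmetry. apply sym_info_eqm.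
    + intros x. apply block_hermitian; intros. apply hermitian_scale, cond_state_cq.
    + intros x i j Hi Hj. destruct (pair_lt i _ _ Hi) as [Hi1 Hi2].
      unfold split_channel. rewrite Msum_entry. replace (S k - 1)%nat with k by lia.
      unfold block.
      rewrite (Csum_ext _ _ (fun a => if Nat.eqb (i / d ^ 2 ^ n) a then
        (if Nat.eqb (j / d ^ 2 ^ n) a then Cmul (RC (/ 2 ^ k))
          (cond_state n k (Nat.testbit a) x (i mod d ^ 2 ^ n) (j mod d ^ 2 ^ n))%nat else Cx0) else Cx0)).
      * rewrite Csum_delta by easy. now rewrite Nat.eqb_sym.
      * intros a _. rewrite avg_state_cond. unfold kron, Mscale, ket_bra.
        destruct (Nat.eqb_spec (i / d ^ 2 ^ n) a), (Nat.eqb_spec (j / d ^ 2 ^ n) a); simpl andb; cbn iota; ring.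
  - apply Rinv_0_lt_compat, pow_lt; lra.
  - rewrite pow_INR. simpl (INR 2). apply Rinv_r, pow_nonzero; lra.
  - intros; apply cond_state_cq.
Qed.

Lemma last_bit_prefix n k u b : 
  cond_state n k (odds (prepend (2 * k) u (scons b zeros))) = cond_state n k (odds u) /\
  cond_state n k (evens (prepend (2 * k) u (scons b zeros))) = cond_state n k (evens u).
Proof.
  split; apply cond_state_prefix; intros j Hj; unfold odds, evens, prepend.
  - now destruct (Nat.ltb_spec (2 * j) (2 * k)), (Nat.ltb_spec (2 * j + 1) (2 * k)); try lia.
  - now destruct (Nat.ltb_spec (2 * j + 1) (2 * k)); try lia.
Qed.

(** Stated for any [g] so as to serve both the information and the Bhattacharyya parameter. Of the
    2k + 1 known bits, k pairs become the prefixes v and w, and the last one is the parameter of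
    [plus_channel]. *)
Lemma level_plus (g : (bool -> Mat) -> R) n k : (k < 2 ^ n)%nat ->
  avgR (2 * k + 1) (fun u => g (cond_state (S n) (2 * k + 1) u))
  = avgR k (fun v => avgR k (fun w => Rmid
      (g (plus_channel (d ^ (2 ^ n)) (cond_state n k v) (cond_state n k w) false))
      (g (plus_channel (d ^ (2 ^ n)) (cond_state n k v) (cond_state n k w) true)))).
Proof.
  intros Hk.
  rewrite <- (average_deinterleave R Rmid Rmid_comm Rmid_medial k (fun v w => Rmid
      (g (plus_channel (d ^ (2 ^ n)) (cond_state n k v) (cond_state n k w) false))
      (g (plus_channel (d ^ (2 ^ n)) (cond_state n k v) (cond_state n k w) true)))).
  transitivity (avgR (S (2 * k)) (fun u => g (cond_state (S n) (2 * k + 1) u)));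
    [f_equal; lia|].
  rewrite average_last. f_equal. extensionality u.
  rewrite !cond_state_plus by easy.
  destruct (last_bit_prefix n k u false) as [-> ->], (last_bit_prefix n k u true) as [-> ->].
  assert (E : forall b, prepend (2 * k) u (scons b zeros) (2 * k)%nat = b).
  { intros b. unfold prepend. now rewrite Nat.ltb_irrefl, Nat.sub_diag. }
  now rewrite !E.
Qed.

Lemma level_minus (g : (bool -> Mat) -> R) n k : (k < 2 ^ n)%nat ->
  avgR (2 * k) (fun u => g (cond_state (S n) (2 * k) u))
  = avgR k (fun v => avgR k (fun w =>
      g (minus_channel (d ^ (2 ^ n)) (cond_state n k v) (cond_state n k w)))).
Proof.
  intros Hk.
  rewrite <- (average_deinterleave R Rmid Rmid_comm Rmid_medial k (fun v w =>
      g (minus_channel (d ^ (2 ^ n)) (cond_state n k v) (cond_state n k w)))).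
  f_equal. extensionality u. now rewrite cond_state_minus.
Qed.

Lemma avgR_const m c : avgR m (fun _ => c) = c.
Proof. induction m; simpl; [easy|]. rewrite IHm. unfold Rmid; field. Qed.

Lemma avgR_scale m c g : avgR m (fun u => c * g u) = c * avgR m g.
Proof.
  symmetry. apply (average_hom R R Rmid Rmid (fun x => c * x)). intros; unfold Rmid; field.
Qed.

Lemma level_info_sum n k : (k < 2 ^ n)%nat ->
  level_info (S n) (2 * k) + level_info (S n) (2 * k + 1) = 2 * level_info n k.
Proof.
  intros Hk. unfold level_info.
  rewrite (level_minus (sym_info (d ^ 2 ^ S n))), (level_plus (sym_info (d ^ 2 ^ S n))) by easy.
  assert (M : forall f g, avgR k f + avgR k g = 2 * avgR k (fun u => Rmid (f u) (g u))).
  { intros f g. rewrite (average_mid R Rmid Rmid_medial). unfold Rmid; field. }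
  rewrite M. f_equal.
  transitivity (avgR k (fun v => Rmid (sym_info (d ^ 2 ^ n) (cond_state n k v))
    (avgR k (fun w => sym_info (d ^ 2 ^ n) (cond_state n k w))))).
  - f_equal. extensionality v. rewrite <- (average_mid R Rmid Rmid_medial).
    rewrite <- (avgR_const k (sym_info _ (cond_state n k v))), <- (average_mid R Rmid Rmid_medial).
    f_equal. extensionality w. rewrite dim_S.
    pose proof (chain_rule _ _ _ _ (cond_state_cq n k v) (cond_state_cq n k w)).
    unfold Rmid in *. lra.
  - rewrite (average_mid R Rmid Rmid_medial), avgR_const. unfold Rmid. field.
Qed.

(** For prefixes v and w the parameter is a product of one factor in v and one in w; since these are
    averaged independently, the averages multiply as well. *)
Lemma level_bhatt_plus n k : (k < 2 ^ n)%nat ->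
  level_bhatt (S n) (2 * k + 1) = level_bhatt n k * level_bhatt n k.
Proof.
  intros Hk. unfold level_bhatt.
  rewrite (level_plus (fun V => bhattacharyya (d ^ 2 ^ S n) (V false) (V true))) by easy.
  rewrite <- avgR_scale. f_equal. extensionality v.
  rewrite Rmult_comm, <- avgR_scale. f_equal. extensionality w.
  rewrite dim_S, !bhattacharyya_plus by apply cond_state_cq. unfold Rmid. field.
Qed.

Lemma level_bounds n k : polar_bounds (level_info n k) (level_bhatt n k).
Proof.
  apply (average_ind2 R R Rmid Rmid polar_bounds).
  - intros a b c e (H1 & H2 & H3 & H4) (K1 & K2 & K3 & K4). unfold Rmid.
    split; [lra|]. split; [lra|]. split.
    + unfold Rdiv in *. lra.
    + intros r Hr. specialize (H4 r Hr). specialize (K4 r Hr). unfold Rdiv in *. lra.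
  - intros u. apply sym_info_bounds, cond_state_cq.
Qed.

Lemma level_info_0 : level_info 0 0 = sym_info d W.
Proof.
  unfold level_info, cond_state. simpl. rewrite Nat.mul_1_r. f_equal.
Qed.

End Channel.

(** * Polarization on the binary tree *)

Definition vanishes (g : nat -> R) : Prop :=
  forall e, 0 < e -> exists N, forall n, (N <= n)%nat -> g n <= e.

Lemma vanishes_comb a b g h k : 0 < a -> 0 < b -> vanishes g -> vanishes h ->
  (forall n, k n <= a * g (S n) + b * h n) -> vanishes k.
Proof.
  intros Ha Hb Hg Hh H e He.
  destruct (Hg (e / (2 * a))) as [N1 H1]; [apply Rdiv_lt_0_compat; lra|].
  destruct (Hh (e / (2 * b))) as [N2 H2]; [apply Rdiv_lt_0_compat; lra|].
  exists (max N1 N2). intros n Hn. specialize (H n).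
  specialize (H1 (S n) ltac:(lia)). specialize (H2 n ltac:(lia)).
  apply (Rmult_le_compat_l a) in H1; [|lra]. apply (Rmult_le_compat_l b) in H2; [|lra].
  replace (a * (e / (2 * a))) with (e / 2) in H1 by (field; lra).
  replace (b * (e / (2 * b))) with (e / 2) in H2 by (field; lra). lra.
Qed.

Definition lvl (n : nat) (g : nat -> R) : R := / 2 ^ n * Rsum (2 ^ n) g.

Lemma pow2_pos n : 0 < 2 ^ n.
Proof. apply pow_lt; lra. Qed.

Lemma Rsum_le n f g : (forall k, (k < n)%nat -> f k <= g k) -> Rsum n f <= Rsum n g.
Proof.
  induction n; intros H; simpl; [lra|].
  apply Rplus_le_compat; [apply IHn; intros; apply H; lia | apply H; lia].
Qed.

Lemma lvl_le n f g : (forall k, (k < 2 ^ n)%nat -> f k <= g k) -> lvl n f <= lvl n g.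
Proof.
  intros H. apply Rmult_le_compat_l; [left; apply Rinv_0_lt_compat, pow2_pos | now apply Rsum_le].
Qed.
Lemma lvl_ext n f g : (forall k, (k < 2 ^ n)%nat -> f k = g k) -> lvl n f = lvl n g.
Proof. intros H. unfold lvl. f_equal. now apply Rsum_ext. Qed.
Lemma lvl_add n f g : lvl n (fun k => f k + g k) = lvl n f + lvl n g.
Proof. unfold lvl. rewrite Rsum_add. ring. Qed.
Lemma lvl_scale n c f : lvl n (fun k => c * f k) = c * lvl n f.
Proof. unfold lvl. rewrite Rsum_mul_l. ring. Qed.
Lemma lvl_const n c : lvl n (fun _ => c) = c.
Proof.
  unfold lvl. rewrite Rsum_const, pow_INR. replace (INR 2) with 2 by (simpl; ring). field.
  apply pow_nonzero; lra.
Qed.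
Lemma lvl_S n g : lvl (S n) g = lvl n (fun k => / 2 * (g (2 * k)%nat + g (2 * k + 1)%nat)).
Proof.
  unfold lvl. rewrite Rsum_mul_l. replace (2 ^ S n)%nat with (2 ^ n * 2)%nat by (simpl; lia).
  rewrite Rsum_pairs. rewrite (Rsum_ext (2 ^ n) _ (fun k => g (2 * k)%nat + g (2 * k + 1)%nat)).
  - simpl pow. field. apply pow_nonzero; lra.
  - intros k _. cbn [Rsum]. rewrite Nat.add_0_r, (Nat.mul_comm k 2). ring.
Qed.

Section Polarization.
(** Node k of level n has the minus child 2k and the plus child 2k + 1; [f] stands for the
    information and [z] for the Bhattacharyya parameter. *)
Variables f z : nat -> nat -> R.
Hypothesis Hsum : forall n k, (k < 2 ^ n)%nat -> f (S n) (2 * k)%nat + f (S n) (2 * k + 1)%nat = 2 * f n k.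
Hypothesis Hz : forall n k, (k < 2 ^ n)%nat -> z (S n) (2 * k + 1)%nat = z n k * z n k.
Hypothesis Hb : forall n k, polar_bounds (f n k) (z n k).

Lemma lvl_mean n : lvl n (f n) = f 0%nat 0%nat.
Proof.
  induction n; [unfold lvl; simpl; field|]. rewrite <- IHn, lvl_S. apply lvl_ext.
  intros k Hk. rewrite Hsum by easy. field.
Qed.

Let V n := lvl n (fun k => f n k ^ 2).
Let E n := lvl n (fun k => (f (S n) (2 * k + 1)%nat - f n k) ^ 2).

(** The two children lie at equal distance on either side of f n k, so the mean of their squares
    exceeds (f n k)^2 by the squared increment. *)
Lemma second_moment_step n : V (S n) = V n + E n.
Proof.
  unfold V, E. rewrite lvl_S, <- lvl_add. apply lvl_ext. intros k Hk.
  specialize (Hsum n k Hk). replace (f (S n) (2 * k)%nat) with (2 * f n k - f (S n) (2 * k + 1)%nat) by lra.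
  field.
Qed.

Lemma E_vanishes : vanishes E.
Proof.
  assert (G : Un_growing V).
  { intros n. rewrite second_moment_step.
    assert (0 <= E n); [|lra]. rewrite <- (lvl_const n 0). apply lvl_le. intros; apply pow2_ge_0. }
  assert (B : has_ub V).
  { exists 1. intros x [n ->]. rewrite <- (lvl_const n 1). apply lvl_le. intros k _.
    destruct (Hb n k) as (H & _). nra. }
  destruct (growing_cv V G B) as [l Hl]. intros e He.
  destruct (Hl (e / 2) ltac:(lra)) as [N HN]. exists N. intros n Hn.
  pose proof (HN n ltac:(lia)) as H1. pose proof (HN (S n) ltac:(lia)) as H2.
  unfold Rdist in *. apply Rabs_def2 in H1, H2. pose proof (second_moment_step n). lra.
Qed.

Fixpoint plus_path (t k : nat) : nat :=
  match t with O => k | S t' => plus_path t' (2 * k + 1) end.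

Let M t n := lvl n (fun k => (f (t + n)%nat (plus_path t k) - f n k) ^ 2).

Lemma M_vanishes t : vanishes (M t).
Proof.
  induction t.
  - intros e He. exists 0%nat. intros n _. unfold M. simpl.
    rewrite (lvl_ext n _ (fun _ => 0)); [rewrite lvl_const; lra | intros; ring].
  - apply (vanishes_comb 4 2 (M t) E); [lra | lra | exact IHt | exact E_vanishes |].
    intros n.
    set (h := fun k => (f (t + S n)%nat (plus_path t k) - f (S n) k) ^ 2).
    (* Plus children are half of the next level, so their mean is at most twice the mean over that
       level. With (x + y)^2 <= 2 x^2 + 2 y^2 this gives the constants 4 and 2. *)
    assert (H : lvl n (fun k => h (2 * k + 1)%nat) <= 2 * M t (S n)).
    { unfold M. fold h. rewrite lvl_S, <- lvl_scale. apply lvl_le. intros k _.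
      assert (0 <= h (2 * k)%nat) by apply pow2_ge_0. lra. }
    apply Rle_trans with (lvl n (fun k => 2 * h (2 * k + 1)%nat + 2 * (f (S n) (2 * k + 1)%nat - f n k) ^ 2)).
    + apply lvl_le. intros k _. unfold h. cbn [plus_path].
      replace (S t + n)%nat with (t + S n)%nat by lia.
      set (a := f (t + S n)%nat _). set (b := f (S n) _). pose proof (pow2_ge_0 (a - b - (b - f n k))).
      nra.
    + rewrite lvl_add, !lvl_scale. fold (E n). lra.
Qed.

Lemma bhatt_path t n k : (k < 2 ^ n)%nat -> z (t + n)%nat (plus_path t k) = z n k ^ (2 ^ t).
Proof.
  revert n k. induction t; intros n k Hk; cbn [plus_path].
  - simpl. ring.
  - replace (S t + n)%nat with (t + S n)%nat by lia.
    rewrite IHt by (simpl; lia). rewrite Hz by easy.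
    replace (2 ^ S t)%nat with (2 * 2 ^ t)%nat by (simpl; lia).
    rewrite pow_mult. f_equal. ring.
Qed.

Definition mid_ind (c r : R) : R :=
  if Rle_dec c r then if Rle_dec r (1 - c) then 1 else 0 else 0.

Lemma mid_vanishes c : 0 < c -> vanishes (fun n => lvl n (fun k => mid_ind c (f n k))).
Proof.
  intros Hc. pose proof ln2_pos as L2.
  (* With this [e] the term 2 e of the upper bound is half of c ln 2. For f >= c the other half is
     left to (1 - z) / e, so 1 - z >= 2 e^2 = eta. *)
  set (e := c * ln 2 / 4). set (eta := e * (2 * e)).
  assert (He : 0 < e) by (unfold e; apply Rdiv_lt_0_compat; nra).
  assert (Heta : 0 < eta) by (unfold eta; nra).
  assert (HZ : forall n k, c <= f n k -> z n k <= 1 - eta).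
  { intros n k H. destruct (Hb n k) as (_ & _ & _ & K). specialize (K e He).
    assert (4 * e <= f n k * ln 2).
    { unfold e. pose proof (Rmult_le_compat_r (ln 2) c (f n k) ltac:(lra) H). lra. }
    assert (2 * e <= (1 - z n k) / e) by lra.
    apply (Rmult_le_compat_l e) in H1; [|lra].
    replace (e * ((1 - z n k) / e)) with (1 - z n k) in H1 by (field; lra).
    unfold eta. lra. }
  (* The number t depends on c alone and not on the node. The threshold makes z / ln 2 <= c / 2, so
     after t plus-steps the information is at least 1 - c / 2. *)
  assert (T : exists t, forall x, 0 <= x <= 1 - eta -> x ^ (2 ^ t) <= c * ln 2 / 2).
  { destruct (Rle_dec 1 eta) as [H1|H1].
    - exists 0%nat. simpl. intros x Hx. assert (0 < c * ln 2) by nra. lra.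
    - destruct (pow_lt_1_zero (1 - eta)) with (y := c * ln 2 / 2) as [N HN].
      + rewrite Rabs_pos_eq; lra.
      + assert (0 < c * ln 2) by nra; lra.
      + exists N. intros x Hx. apply Rle_trans with ((1 - eta) ^ (2 ^ N)).
        * apply pow_incr; lra.
        * assert (N <= 2 ^ N)%nat by (apply Nat.lt_le_incl, Nat.pow_gt_lin_r; lia).
          specialize (HN (2 ^ N)%nat ltac:(lia)).
          rewrite Rabs_pos_eq in HN by (apply pow_le; lra). lra. }
  destruct T as [t HT]. intros e' He'.
  destruct (M_vanishes t (c ^ 2 / 4 * e')) as [N HN]; [apply Rmult_lt_0_compat; nra|].
  exists N. intros n Hn. specialize (HN n Hn).
  (* Chebyshev: a node with value at most 1 - c that ends at 1 - c / 2 or above contributes at least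
     (c / 2)^2 to [M t n]. *)
  assert (H : c ^ 2 / 4 * lvl n (fun k => mid_ind c (f n k)) <= M t n).
  { rewrite <- lvl_scale. apply lvl_le. intros k Hk. unfold mid_ind.
    pose proof (pow2_ge_0 (f (t + n)%nat (plus_path t k) - f n k)).
    destruct (Rle_dec c (f n k)) as [H1|]; [|lra]. destruct (Rle_dec _ _) as [H2|]; [|lra].
    specialize (HZ n k H1). destruct (Hb n k) as (_ & Z0 & _).
    specialize (HT (z n k) ltac:(lra)). rewrite <- bhatt_path in HT by easy.
    destruct (Hb (t + n)%nat (plus_path t k)) as (_ & _ & K & _).
    assert (z (t + n)%nat (plus_path t k) / ln 2 <= c / 2).
    { apply (Rmult_le_reg_r (ln 2)); [lra|]. unfold Rdiv. rewrite Rmult_assoc, Rinv_l by lra. lra. }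
    assert (c / 2 <= f (t + n)%nat (plus_path t k) - f n k) by lra. nra. }
  apply (Rmult_le_reg_l (c ^ 2 / 4)); [nra|]. lra.
Qed.

(* The affine target [l + s * r] covers both limits, r and 1 - r. *)
Lemma fraction_cv (ind : R -> R) (l : R) (s : R) :
  (forall c0, 0 < c0 -> exists c, 0 < c <= c0 /\
     forall r, 0 <= r <= 1 -> Rabs (ind r - (l + s * r)) <= c + mid_ind c r) ->
  Un_cv (fun n => lvl n (fun k => ind (f n k))) (l + s * f 0%nat 0%nat).
Proof.
  intros H e He. destruct (H (e / 4) ltac:(lra)) as (c & Hc & K).
  destruct (mid_vanishes c ltac:(lra) (e / 4) ltac:(lra)) as [N HN].
  exists N. intros n Hn. specialize (HN n Hn). unfold Rdist.
  (* An affine function of the information has a level mean that does not depend on n; this constant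
     is the limit. *)
  assert (A : lvl n (fun k => l + s * f n k) = l + s * f 0%nat 0%nat).
  { now rewrite lvl_add, lvl_const, lvl_scale, lvl_mean. }
  assert (B : lvl n (fun k => c + mid_ind c (f n k)) <= e / 2).
  { rewrite lvl_add, lvl_const. lra. }
  rewrite <- A. apply Rabs_def1.
  - apply Rle_lt_trans with (e / 2); [|lra].
    apply Rle_trans with (2 := B). apply Rplus_le_reg_r with (lvl n (fun k => l + s * f n k)).
    replace (lvl n (fun k => ind (f n k)) - _ + _) with (lvl n (fun k => ind (f n k))) by ring.
    rewrite <- lvl_add. apply lvl_le. intros k _. destruct (Hb n k) as (H0 & _).
    pose proof (Rle_trans _ _ _ (Rle_abs _) (K _ H0)). lra.
  - apply Rlt_le_trans with (- (e / 2)); [lra|].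
    enough (lvl n (fun k => l + s * f n k) <= lvl n (fun k => c + mid_ind c (f n k)) + lvl n (fun k => ind (f n k))) by lra.
    rewrite <- lvl_add. apply lvl_le. intros k _. destruct (Hb n k) as (H0 & _).
    (* [Rabs_Ropp] carries the bound over to the negated difference, which gives the estimate from
       below. *)
    pose proof (Rle_trans _ _ _ (Rle_abs _) (eq_ind_r (fun x => x <= _) (K _ H0) (Rabs_Ropp _))). lra.
Qed.
End Polarization.

(** * Fractions of good and bad indices *)

Definition indicator (b : bool) : R := if b then 1 else 0.

Lemma count_lvl (p : nat -> bool) n :
  INR (length (filter p (seq 1 (2 ^ n)))) / INR (2 ^ n) = lvl n (fun k => indicator (p (S k))).
Proof.
  unfold lvl. rewrite pow_INR. replace (INR 2) with 2 by (simpl; ring). unfold Rdiv. rewrite Rmult_comm. f_equal.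
  generalize (2 ^ n)%nat. intros m. induction m; [reflexivity|].
  rewrite seq_S, filter_app, length_app, plus_INR, IHm. simpl Rsum. f_equal.
  simpl. unfold indicator. destruct (p (S m)); reflexivity.
Qed.

Lemma mid_cases (delta : R) : 0 < delta < 1 -> forall c0, 0 < c0 -> exists c, 0 < c <= c0 /\ c <= delta /\ c <= 1 - delta.
Proof.
  intros H c0 H0. exists (Rmin c0 (Rmin delta (1 - delta))).
  assert (0 < Rmin c0 (Rmin delta (1 - delta))) by (repeat apply Rmin_glb_lt; lra).
  pose proof (Rmin_l c0 (Rmin delta (1 - delta))). pose proof (Rmin_r c0 (Rmin delta (1 - delta))).
  pose proof (Rmin_l delta (1 - delta)). pose proof (Rmin_r delta (1 - delta)). lra.
Qed.

(** Both thresholds delta and 1 - delta lie in [c, 1 - c]. Outside this interval the indicator is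
    constant on each side and within c of r; inside, [mid_ind] contributes 1. *)
Lemma good_close delta c r : 0 < c -> c <= delta -> c <= 1 - delta -> 0 <= r <= 1 ->
  Rabs (indicator (in_good delta r) - (0 + 1 * r)) <= c + mid_ind c r.
Proof.
  intros. unfold indicator, in_good, mid_ind.
  destruct (Rlt_dec _ _), (Rle_dec r 1), (Rle_dec c r); try destruct (Rle_dec r (1 - c));
    apply Rabs_le; lra.
Qed.

Lemma bad_close delta c r : 0 < c -> c <= delta -> c <= 1 - delta -> 0 <= r <= 1 ->
  Rabs (indicator (in_bad delta r) - (1 + -1 * r)) <= c + mid_ind c r.
Proof.
  intros. unfold indicator, in_bad, mid_ind.
  destruct (Rle_dec 0 r), (Rlt_dec r delta), (Rle_dec c r); try destruct (Rle_dec r (1 - c));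
    apply Rabs_le; lra.
Qed.

Theorem theorem1 (d : nat) (W : bool -> Mat) (delta : R)
  (HW : is_cq_channel d W) (Hdelta : 0 < delta < 1) :
  Un_cv (fun n => INR (count_good d W delta n) / INR (2 ^ n)) (sym_info d W) /\
  Un_cv (fun n => INR (count_bad d W delta n) / INR (2 ^ n)) (1 - sym_info d W).
Proof.
  pose proof (level_info_sum d W HW) as Hsum.
  pose proof (level_bhatt_plus d W HW) as Hz.
  pose proof (level_bounds d W HW) as Hb.
  assert (L : forall (p : R -> bool) n,
    INR (length (filter (fun i => p (split_info d W n i)) (seq 1 (2 ^ n)))) / INR (2 ^ n)
    = lvl n (fun k => indicator (p (level_info d W n k)))).
  { intros p n. rewrite count_lvl. apply lvl_ext. intros k _. now rewrite split_info_level. }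
  rewrite <- (level_info_0 d W). split.
  - apply (Un_cv_ext (fun n => lvl n (fun k => indicator (in_good delta (level_info d W n k))))).
    + intros n. symmetry. apply (L (in_good delta)).
    + replace (level_info d W 0 0) with (0 + 1 * level_info d W 0 0) by ring.
      apply (fraction_cv _ _ Hsum Hz Hb (fun r => indicator (in_good delta r)) 0 1).
      intros c0 Hc0. destruct (mid_cases delta Hdelta c0 Hc0) as (c & Hc & H1 & H2).
      exists c. split; [easy|]. intros r Hr. apply good_close; lra.
  - apply (Un_cv_ext (fun n => lvl n (fun k => indicator (in_bad delta (level_info d W n k))))).
    + intros n. symmetry. apply (L (in_bad delta)).
    + replace (1 - level_info d W 0 0) with (1 + -1 * level_info d W 0 0) by ring.
      apply (fraction_cv _ _ Hsum Hz Hb (fun r => indicator (in_bad delta r)) 1 (-1)).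
      intros c0 Hc0. destruct (mid_cases delta Hdelta c0 Hc0) as (c & Hc & H1 & H2).
      exists c. split; [easy|]. intros r Hr. apply bad_close; lra.
Qed.
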